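(* If $G$ is a planar graph without $4$-cycles (i.e. with no cycle of length $4$ as a subgraph) and with maximum degree $\Delta(G)\geq 5$, then $G$ is edge-$(\Delta(G)+1)$-group choosable.
   Context: All graphs are finite and simple; $\Delta(G)$ is the maximum degree of $G$. $\ell(G)$ denotes the line graph of $G$ (its vertices are the edges of $G$, two being adjacent iff they share an endpoint in $G$). Let $H$ be a graph with a fixed orientation of its edges, $A$ an Abelian group, $L:V(H)\to 2^A$ a list assignment and $f:E(H)\to A$. An $(A,L,f)$-coloring of $H$ is a map $c:V(H)\to A$ with $c(v)\in L(v)$ for every vertex $v$ and $c(x)-c(y)\neq f(xy)$ for every edge $xy$ directed from $x$ to $y$. $H$ is $(A,L)$-colorable if it has an $(A,L,f)$-coloring for every $f:E(H)\to A$ (this does not depend on the orientation). $H$ is $k$-group choosable if it is $(A,L)$-colorable for every Abelian group $A$ of order at least $k$ and every $L$ with $|L(v)|=k$ for all $v\in V(H)$. $G$ is edge-$k$-group choosable if $\ell(G)$ is $k$-group choosable. *)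

(* Defs.v *)
From HB Require Import structures.
From mathcomp Require Import all_boot all_order all_algebra.
From mathcomp Require Import all_classical all_reals all_analysis.
Import Order.TTheory GRing.Theory Num.Theory.
Import numFieldNormedType.Exports.

Set Implicit Arguments.
Unset Strict Implicit.
Unset Printing Implicit Defensive.

Local Open Scope ring_scope.

Record sgraph := SGraph {
  vertex :> finType;
  adj : rel vertex;
  adj_sym : symmetric adj;
  adj_irr : irreflexive adj }.

Arguments adj {s} x y.

Definition degree (G : sgraph) (v : G) : nat := #|[set w : G | adj v w]|.

Definition max_degree (G : sgraph) : nat := \max_(v : G) degree v.

Definition edge_set (G : sgraph) : {set {set G}} :=
  [set [set p.1; p.2] | p : G * G & adj p.1 p.2].

Definition edge (G : sgraph) : finType := {e : {set G} | e \in edge_set G}.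

(* Meaningful for n >= 3 only: ucycle also accepts shorter sequences. *)
Definition has_cycle_of_length (G : sgraph) (n : nat) : Prop :=
  exists s : seq G, ucycle adj s /\ size s = n.

Definition line_adj (G : sgraph) : rel (edge G) :=
  fun e1 e2 => (e1 != e2) && (val e1 :&: val e2 != finset.set0).

Lemma line_adj_sym (G : sgraph) : symmetric (@line_adj G).
Proof. by move=> e1 e2; rewrite /line_adj eq_sym finset.setIC. Qed.

Lemma line_adj_irr (G : sgraph) : irreflexive (@line_adj G).
Proof. by move=> e; rewrite /line_adj eqxx. Qed.

Definition line_graph (G : sgraph) : sgraph :=
  SGraph (@line_adj_sym G) (@line_adj_irr G).

(* A drawing in the plane R^2: pos places the vertices at distinct points, and
   arc e, restricted to [0, 1], is a simple arc joining the two ends of e; the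
   inside of an arc contains no vertex and meets the inside of no other arc. *)
Definition plane_drawing (R : realType) (G : sgraph)
    (pos : G -> R * R) (arc : edge G -> R -> R * R) : Prop :=
  [/\ injective pos,
      forall e, {within `[0, 1], continuous (arc e)}%classic /\
                {in `[0, 1] &, injective (arc e)},
      forall e, exists x y : G,
        [/\ val e = [set x; y], arc e 0 = pos x & arc e 1 = pos y],
      forall e t v, t \in `]0, 1[ -> arc e t <> pos v
    & forall e1 e2 t1 t2, t1 \in `]0, 1[ -> t2 \in `]0, 1[ ->
        arc e1 t1 = arc e2 t2 -> e1 = e2].

Definition planar (R : realType) (G : sgraph) : Prop :=
  exists pos arc, @plane_drawing R G pos arc.

(* D x y means that the edge xy is directed from x to y. *)
Definition orientation (H : sgraph) (D : rel H) : Prop :=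
  (forall x y, D x y -> adj x y) /\ (forall x y, adj x y -> D x y (+) D y x).

Definition coloring (H : sgraph) (D : rel H) (A : zmodType) (L : H -> set A)
    (f : edge H -> A) (c : H -> A) : Prop :=
  (forall v, L v (c v)) /\
  (forall (e : edge H) x y, val e = [set x; y] -> D x y -> c x - c y <> f e).

(* Quantifying over all orientations is the same as fixing one of them: see
   orientation_exists and group_colorableP below. *)
Definition group_colorable (H : sgraph) (A : zmodType) (L : H -> set A) : Prop :=
  forall D : rel H, orientation D ->
  forall f : edge H -> A, exists c : H -> A, coloring D L f c.

(* A may be infinite; the two cardinality conditions say that A has at least k
   elements and that every list has exactly k. *)
Definition group_choosable (H : sgraph) (k : nat) : Prop :=
  forall A : zmodType, (`I_k #<= [set: A])%classic%card ->
  forall L : H -> set A, (forall v, (L v #= `I_k)%classic%card) ->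
  group_colorable L.

Definition edge_group_choosable (G : sgraph) (k : nat) : Prop :=
  group_choosable (line_graph G) k.

Lemma orientation_exists (H : sgraph) : exists D : rel H, orientation D.
Proof.
exists (fun x y => adj x y && (enum_rank x < enum_rank y)%N).
split=> [x y /andP[]//|x y xy].
rewrite xy adj_sym xy /=; case: ltngtP => // /val_inj/enum_rank_inj exy.
by rewrite exy adj_irr in xy.
Qed.

Lemma group_colorableP (H : sgraph) (D : rel H) (A : zmodType) (L : H -> set A) :
  orientation D ->
  (group_colorable L <->
   forall f : edge H -> A, exists c : H -> A, coloring D L f c).
Proof.
move=> [Dadj Dor]; split=> [col|col D' [D'adj D'or] f]; first exact: col.
pose agree (e : edge H) :=
  [exists x, exists y, [&& val e == [set x; y], D x y & D' x y]].
have [c [cL cD]] := col (fun e => if agree e then f e else - f e).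
exists c; split=> // e x y exy D'xy.
have xy := D'adj _ _ D'xy.
case Dxy: (D x y).
  have := cD e x y exy Dxy.
  suff -> : agree e by [].
  by apply/existsP; exists x; apply/existsP; exists y; rewrite exy eqxx Dxy.
have Dyx : D y x by have := Dor _ _ xy; rewrite Dxy.
have eyx : val e = [set y; x] by rewrite exy finset.setUC.
have := cD e y x eyx Dyx.
suff -> : agree e = false by move=> + cf; apply; rewrite -cf opprB.
apply/negbTE/existsP=> -[u /existsP[v /and3P[/eqP euv Duv D'uv]]].
have uxy : u \in [set x; y] by rewrite -exy euv !inE eqxx.
have vxy : v \in [set x; y] by rewrite -exy euv !inE eqxx orbT.
have uv := Dadj _ _ Duv.
have D'yx : D' y x = false by have := D'or _ _ xy; rewrite D'xy; case: (D' y x).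
move: uxy vxy; rewrite !inE => /orP[]/eqP eu /orP[]/eqP ev; subst u v.
- by rewrite adj_irr in uv.
- by rewrite Dxy in Duv.
- by rewrite D'yx in D'uv.
- by rewrite adj_irr in uv.
Qed.

(* Main.v *)
Require Import Defs.
From mathcomp Require Import all_boot all_order all_algebra.
From mathcomp Require Import zify ring lra.
From mathcomp Require boolp.

Set Implicit Arguments.
Unset Strict Implicit.
Unset Printing Implicit Defensive.
Import Order.TTheory GRing.Theory Num.Theory.

(** Let D be the maximum degree, and let X be a smallest set of edges of G that
    cannot be coloured from lists of D + 1 elements. An edge xy of X with
    d(x) + d(y) <= D + 2 would meet at most D other edges of X and could be
    coloured last; hence d(x) + d(y) >= D + 3 for all xy in X, and in particular
    every vertex on X has degree at least 3. Call xy tight if equality holds.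
    A cycle of tight edges with one more tight edge attached can be coloured
    last as well ([cycle_plus_edge_reducible]): two of these edges which do not
    meet, but which both meet a third one, can be coloured so as to cost the
    third one a single colour, and the others are then coloured greedily towards
    it. Consequently every set W of vertices spans at most |W| tight edges
    ([card_inner]).

    Planarity bounds the number of edges from the other side. Without 4-cycles a
    face is a triangle or has at least five edges, and an edge lies on at most
    one triangle, so that at most floor (d(v) / 2) triangles meet at v. Euler's
    formula then gives  sum_v (30 - 9 d(v) + 4 floor (d(v) / 2)) >= 60
    ([euler_bound]). Only vertices of degree 3 and 4 contribute positively to the
    sum. Their edges are tight or lead to vertices of large degree, and counting
    these edges shows that the sum is at most 0 ([euler_bound_fails]).

    Euler's inequality is read off the drawing without the Jordan curve theorem.
    The arcs are first replaced by polygons which leave the vertices along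
    disjoint straight segments ([rotation_system]). For an even set z of edges,
    one that has even degree at every vertex, count modulo 2 the crossings of z
    with the vertical ray above a point x. This parity does not change when x
    moves along a segment that avoids z ([parity_disjoint]). So the sector
    between two consecutive edges at a vertex defines a function of z, and these
    functions serve as the faces of the drawing: crossing an edge e adds the
    function which tells whether e is in z, and following e from one end to the
    other keeps the pair of functions on its two sides ([sides_agree]). The faces
    separate the even sets, and there are at least 2 ^ (|X| - |V| + 1) even sets;
    with F faces this yields  |X| - |V| + 1 <= F - 1  ([euler_faces]). The edges
    that border a given face form an even set ([boundary_even]), which is what
    makes triangles the only short faces. *)

(** * Colouring from lists with shifted conflicts *)

Section ShiftColoring.
Variables (E : finType) (conf : rel E) (A : zmodType) (g : E -> E -> A).
Variables (k : nat) (L : E -> seq A).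
Hypothesis conf_sym : symmetric conf.
Hypothesis conf_irr : irreflexive conf.
Hypothesis gN : forall e e', g e' e = (- g e e')%R.
Hypothesis L_uniq : forall e, uniq (L e).
Hypothesis L_size : forall e, size (L e) = k.

Definition nbrs (X : {set E}) (e : E) := [set e' in X | conf e e'].

(** The restriction of an (A, L, f)-colouring to X, with the orientation folded
    into the antisymmetric shift g. *)
Definition proper_on (X : {set E}) (c : E -> A) :=
  {in X, forall e, c e \in L e} /\
  {in X &, forall e e', conf e e' -> c e != (c e' + g e e')%R}.

Definition colorable (X : {set E}) := exists c, proper_on X c.

Definition blocked (c : E -> A) (Y : {set E}) (e : E) :=
  [seq (c e' + g e e')%R | e' <- enum (nbrs Y e)].

Definition available (c : E -> A) (Y : {set E}) (e : E) :=
  [seq x <- L e | x \notin blocked c Y e].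

Definition recolor (c : E -> A) e a : E -> A := fun x => if x == e then a else c x.

Lemma proper_on_recolor Y c e a : proper_on Y c -> e \notin Y -> a \in available c Y e ->
  proper_on (e |: Y) (recolor c e a).
Proof.
move=> [cL cP] eY; rewrite mem_filter => /andP[ab aL].
have nbl e' : e' \in Y -> conf e e' -> a != (c e' + g e e')%R.
  move=> e'Y ee'; apply: contraNneq ab => ->.
  by apply/mapP; exists e' => //; rewrite mem_enum inE e'Y.
split=> [x|x y]; rewrite !inE /recolor.
  by case: eqP => [-> _ //|_ /= xY]; exact: cL.
case: (eqVneq x e) => [->|xe] /=; case: (eqVneq y e) => [->|ye] /= xY yY lxy.
- by rewrite conf_irr in lxy.
- exact: nbl.
- have := nbl x xY; rewrite conf_sym => /(_ lxy); apply: contraNneq => ->.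
  by rewrite gN subrK.
- exact: cP.
Qed.

Lemma size_available c Y e : k <= size (available c Y e) + #|nbrs Y e|.
Proof.
rewrite size_filter -(L_size e) -(count_predC [in blocked c Y e] (L e)) addnC.
rewrite leq_add2l -size_filter.
have -> : #|nbrs Y e| = size (blocked c Y e) by rewrite size_map cardE.
apply: uniq_leq_size; first exact: filter_uniq.
by move=> x; rewrite mem_filter => /andP[].
Qed.

Lemma available_gt0 c Y e : #|nbrs Y e| < k -> exists a, a \in available c Y e.
Proof.
move=> lt; have := size_available c Y e.
case: (available c Y e) => [|a s _]; first by rewrite add0n leqNgt lt.
by exists a; rewrite mem_head.
Qed.

Lemma nbrsS (X Y : {set E}) e : X \subset Y -> nbrs X e \subset nbrs Y e.
Proof. by move=> XY; apply/subsetP=> x; rewrite !inE => /andP[/(subsetP XY) -> ->]. Qed.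

Lemma nbrsD (X : {set E}) (e x : E) : x \in X -> conf e x -> 
  #|nbrs (X :\ x) e|.+1 = #|nbrs X e|.
Proof.
move=> xX ex; rewrite [RHS](cardsD1 x) !inE xX ex add1n; congr (_.+1).
by apply: eq_card => y; rewrite !inE; case: (y == x); rewrite //= andbA.
Qed.

(** An element with a spare colour can be added to any colouring of the rest. *)
Lemma min_degree_noncolorable X : ~ colorable X ->
  (forall Y : {set E}, Y \proper X -> colorable Y) -> {in X, forall e, k <= #|nbrs X e|}.
Proof.
move=> nX mX e eX; rewrite leqNgt; apply/negP=> lt; apply: nX.
have [|c cP] := mX (X :\ e); first by rewrite properD1.
have [|a aF] := @available_gt0 c (X :\ e) e.
  by apply: leq_ltn_trans lt; rewrite subset_leq_card // nbrsS // subD1set.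
by exists (recolor c e a); rewrite -(setD1K eX); apply: proper_on_recolor; rewrite ?setD11.
Qed.

(** Colouring s from left to right succeeds if every element still has a
    colour left by the neighbours that precede it. *)
Lemma greedy s Y c : proper_on Y c -> uniq s -> {in s, forall e, e \notin Y} ->
  (forall s1 e s2, s = s1 ++ e :: s2 -> #|nbrs (Y :|: [set x in s1]) e| < k) ->
  exists2 c', proper_on (Y :|: [set x in s]) c' & {in Y, c' =1 c}.
Proof.
elim: s Y c => [|e s IH] Y c cP.
  move=> _ _ _; exists c => //.
  by rewrite (_ : [set x in [::]] = set0) ?setU0 //; apply/setP=> x; rewrite !inE.
rewrite cons_uniq => /andP[es us] sY H.
have eY : e \notin Y by rewrite sY ?mem_head.
have [|a aF] := @available_gt0 c Y e.
  have := H [::] e s erefl; congr (_ < _); apply: eq_card => x.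
  by rewrite !inE orbF.
have [| |c' c'P c'E] := IH (e |: Y) (recolor c e a) (proper_on_recolor cP eY aF) us.
- move=> x xs; rewrite in_setU1 negb_or sY ?inE ?xs ?orbT // andbT.
  by apply: contraNneq es => <-.
- move=> s1 x s2 Es; have := H (e :: s1) x s2; rewrite Es => /(_ erefl).
  congr (_ < _); apply: eq_card => y; rewrite !inE.
  by rewrite orbA [(y \in Y) || _]orbC.
exists c'.
  suff <- : e |: Y :|: [set x in s] = Y :|: [set x in e :: s] by [].
  by apply/setP=> x; rewrite !inE orbA [(x \in Y) || _]orbC.
move=> x xY; rewrite c'E ?inE ?xY ?orbT // /recolor; case: eqP => // xe.
by rewrite -xe xY in eY.
Qed.

(** If b and c share a value, it can serve as both x and y; if one of them has a
    value outside a, that value does no harm. Otherwise b and c supply four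
    values, all of them in a, and a is large enough to lose two. *)
Lemma save_color (T : eqType) (b c a : seq T) : uniq b -> uniq c -> uniq a ->
  1 < size b -> 1 < size c -> 2 < size a ->
  exists x y, [/\ x \in b, y \in c &
    1 < size [seq z <- a | z \notin [:: x; y]]].
Proof.
move=> ub uc ua b2 c2 a3.
have drop2 (s : seq T) x y : uniq s -> 
    size s <= size [seq z <- s | z \notin [:: x; y]] + 
       ((x \in s) + ((y \in s) && (y != x))).
  move=> us; rewrite size_filter -(count_predC [in [:: x; y]] s) addnC leq_add2l.
  rewrite -size_filter; set t := [seq _ <- _ | _].
  pose t' := (if x \in s then [:: x] else [::]) ++ 
             (if (y \in s) && (y != x) then [:: y] else [::]).
  have -> : (x \in s) + ((y \in s) && (y != x)) = size t'.
    by rewrite size_cat; case: (x \in s); case: (_ && _).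
  apply: uniq_leq_size; first exact: filter_uniq.
  move=> z; rewrite mem_filter !inE => /andP[] /orP[]/eqP-> zs; rewrite /t' mem_cat.
    by rewrite zs mem_head.
  rewrite zs; case: (eqVneq y x) => [<-|_] /=; first by rewrite zs mem_head.
  by rewrite mem_head orbT.
case: (@hasP _ (mem c) b) => [[x xb xc]|nbc].
  by exists x, x; split=> //; have := drop2 a x x ua; rewrite eqxx andbF; lia.
case/boolP: (all (mem a) (b ++ c)) => [/allP sub|/allPn[t]].
  have a4 : 3 < size a.
    apply: leq_trans (uniq_leq_size (s1 := b ++ c) _ _).
    - by rewrite size_cat; lia.
    - rewrite cat_uniq ub uc andbT /=; apply/hasPn=> y yc; apply/negP=> yb.
      by apply: nbc; exists y.
    - exact: sub.
  case: b ub b2 {nbc sub} => // x b _ _; case: c uc c2 => // y c _ _.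
  exists x, y; rewrite !mem_head; split=> //; have := drop2 a x y ua.
  by case: (x \in a); case: (_ && _); lia.
rewrite mem_cat inE => /orP[tb|tc] ta.
  case: c uc c2 {nbc} => // y c _ _; exists t, y; rewrite mem_head; split=> //.
  by have := drop2 a t y ua; rewrite (negPf ta); case: (_ && _); lia.
case: b ub b2 {nbc} => // y b _ _; exists y, t; rewrite mem_head; split=> //.
by have := drop2 a y t ua; rewrite (negPf ta); case: (y \in a); lia.
Qed.

(** In the line graph, a, c, s is a cycle and b an extra element adjacent to a
    and to the last element of s: for a graph cycle v0 v1 ... vm with a pendant
    edge v0 w take a = v0 v1, b = v0 w, c = v1 v2 and s = v2 v3, ..., vm v0.
    After the rest of X, colour b and c so as to save a colour for a
    ([save_color]), then s greedily, each element having its successor still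
    uncoloured, and finally a. *)
Lemma cycle_plus_edge_reducible (X : {set E}) a b c s :
  (forall Y : {set E}, Y \proper X -> colorable Y) ->
  uniq [:: a, b, c & s] -> {subset [:: a, b, c & s] <= X} ->
  {in [:: a, b, c & s], forall e, #|nbrs X e| <= k} ->
  s != [::] -> ~~ conf b c -> conf a b ->
  path conf a (c :: s) -> conf (last c s) a -> conf (last c s) b ->
  {in s, forall e, e != last c s -> ~~ conf a e} ->
  colorable X.
Proof.
move=> mX uS sX dS s0 bc ab /= /andP[ac cs] da db aS.
set d := last c s in da db aS.
have ds : d \in s by rewrite /d; case: (s) s0 => //= x s' _; exact: mem_last.
have [aX bX cX] : [/\ a \in X, b \in X & c \in X] by split; apply: sX; rewrite !inE eqxx ?orbT.
have sX' : {subset s <= X} by move=> x xs; apply: sX; rewrite !inE xs !orbT.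
have {}dS : [/\ #|nbrs X a| <= k, #|nbrs X b| <= k, #|nbrs X c| <= k & {in s, forall e, #|nbrs X e| <= k}].
  by split; [| | |move=> x xs]; apply: dS; rewrite !inE ?eqxx ?xs ?orbT.
case: dS => da_k db_k dc_k ds_k.
move: uS; rewrite /= !inE !negb_or -!andbA => /andP[nab /and5P[nac nas nbc nbs /andP[ncs us]]].
pose S := [set x in [:: a, b, c & s]].
have [|f0 f0P] := mX (X :\: S).
  apply/properP; split; first exact: subsetDl.
  by exists a; rewrite // !inE eqxx.
have nbX2 e x y : x != y -> x \in X -> y \in X -> x \in S -> y \in S -> 
    conf e x -> conf e y -> #|nbrs (X :\: S) e| + 2 <= #|nbrs X e|.
  move=> xy xX yX xS yS ex ey; rewrite -(nbrsD xX ex) -(@nbrsD (X :\ x) e y) ?inE ?yX ?andbT 1?eq_sym //.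
  rewrite addn2 !ltnS; apply: subset_leq_card; apply: nbrsS; apply/subsetP => z.
  rewrite in_setD => /andP[zS zX]; rewrite !inE zX andbT.
  by apply/andP; split; apply: contraNneq zS => ->.
have inS x : x \in [:: a, b, c & s] -> x \in S by move=> xs; rewrite inE.
have [h hs ch] : exists2 h, h \in s & conf c h.
  by case: (s) s0 cs => //= h s' _ /andP[ch _]; exists h; rewrite ?mem_head.
have nda : d != a by apply: contraNneq nas => <-.
have nha : h != a by apply: contraNneq nas => <-.
have [aS' bS' cS' dS' hS'] : [/\ a \in S, b \in S, c \in S, d \in S & h \in S].
  by split; apply: inS; rewrite !inE ?eqxx ?ds ?hs ?orbT.
have room n F m j : k <= F + n -> n + j <= m -> m <= k -> j <= F by clear; lia.
have b2 : 2 <= size (available f0 (X :\: S) b).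
  by apply: room (size_available _ _ _) (nbX2 b a d _ aX (sX' _ ds) aS' dS' _ _) _; rewrite // 1?eq_sym // conf_sym.
have c2 : 2 <= size (available f0 (X :\: S) c).
  by apply: room (size_available _ _ _) (nbX2 c a h _ aX (sX' _ hs) aS' hS' _ _) _; rewrite // 1?eq_sym // conf_sym.
have ndb : d != b by apply: contraNneq nbs => <-.
have ndc : d != c by apply: contraNneq ncs => <-.
have a3 : 3 <= size (available f0 (X :\: S) a).
  apply: room (size_available _ _ _) _ da_k.
  rewrite -(nbrsD bX ab) -(@nbrsD (X :\ b) a c) ?inE ?cX ?andbT 1?eq_sym //.
  rewrite -(@nbrsD (X :\ b :\ c) a d) ?inE ?sX' ?ndb ?ndc //; last by rewrite conf_sym.
  rewrite addn3 !ltnS; apply: subset_leq_card; apply: nbrsS; apply/subsetP => z.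
  rewrite in_setD => /andP[zS zX]; rewrite !inE zX andbT.
  by apply/and3P; split; apply: contraNneq zS => ->; rewrite !inE ?eqxx ?ds ?orbT.
have fu e : uniq (available f0 (X :\: S) e) by exact: filter_uniq.
pose tr (e : E) := fun x : A => (x + g a e)%R.
have trI e : injective (tr e) by exact: addIr.
have [| | | |x' [y' [/mapP[x xF ->] /mapP[y yF ->] save]]] :=
  @save_color _ (map (tr b) (available f0 (X :\: S) b)) (map (tr c) (available f0 (X :\: S) c))
     (available f0 (X :\: S) a) _ _ (fu a) _ _ a3; rewrite ?size_map ?map_inj_uniq //.
have bS : b \notin X :\: S by rewrite in_setD inS ?inE ?eqxx ?orbT.
pose f1 := recolor f0 b x; have f1P : proper_on (b |: X :\: S) f1 by exact: proper_on_recolor.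
have cS : c \notin b |: X :\: S.
  by rewrite in_setU1 in_setD inS ?inE ?eqxx ?orbT //= orbF eq_sym.
pose f2 := recolor f1 c y.
have f2P : proper_on (c |: (b |: X :\: S)) f2.
  apply: proper_on_recolor => //; move: yF; rewrite !mem_filter => /andP[yB ->].
  rewrite andbT; apply: contra yB => /mapP[z].
  rewrite mem_enum inE in_setU1 => /andP[/orP[/eqP->|zX] cz zE].
    by rewrite conf_sym (negPf bc) in cz.
  apply/mapP; exists z; first by rewrite mem_enum inE zX.
  by rewrite zE /f1 /recolor; case: eqP => // zb; rewrite -zb zX in bS.
set Y := _ |: _ in f2P.
have YS z : z \in Y -> z \notin a :: s.
  rewrite /Y in_setU1 in_setU1 in_setD => /or3P[/eqP->|/eqP->|/andP[zS _]].
  - by rewrite inE negb_or eq_sym nac.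
  - by rewrite inE negb_or eq_sym nab.
  apply: contra zS; rewrite inE => /orP[/eqP->|zs] //.
  by apply: inS; rewrite !inE zs !orbT.
have Yb z : z \in Y -> z \in X by rewrite !inE => /or3P[/eqP->|/eqP->|/andP[]].
have aY : a \notin Y by apply/negP => /YS; rewrite mem_head.
have [|s1 e s2 Es|f3 f3P f3E] := greedy f2P us.
- by move=> e es; apply/negP => /YS; rewrite inE es orbT.
- have es : e \in s by rewrite Es mem_cat mem_head orbT.
  (* the successor of e in s, or a when e is the last edge, is still uncoloured *)
  have [e' [e'X ee' e'N]] : exists e', [/\ e' \in X, conf e e' & e' \notin Y :|: [set x in s1]].
    case: s2 Es => [|e' s2] Es.
      exists a; split=> //; last by rewrite in_setU negb_or aY inE (contra _ nas) // Es mem_cat => ->.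
      by move: da; rewrite /d Es last_cat /=.
    have e's : e' \in s by rewrite Es mem_cat !inE eqxx !orbT.
    exists e'; split; [exact: sX'| |].
      by move: cs; rewrite Es cat_path /= => /and4P[].
    rewrite in_setU negb_or inE; apply/andP; split.
      by apply/negP => /YS; rewrite inE e's orbT.
    move: us; rewrite Es cat_uniq => /and3P[_ /hasPn/(_ e') + _].
    by rewrite !inE eqxx orbT => /(_ isT).
  apply: leq_trans (ds_k e es); rewrite -(nbrsD e'X ee') ltnS.
  apply: subset_leq_card; apply: nbrsS; apply/subsetP => z zY; rewrite in_setD1.
  apply/andP; split; first by apply: contraTneq zY => ->.
  move: zY; rewrite in_setU => /orP[/Yb //|]; rewrite inE => zs.
  by apply: sX'; rewrite Es mem_cat zs.
have [z] : exists z, z \in available f3 (Y :|: [set x in s]) a.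
  have sub : {subset [seq z <- available f0 (X :\: S) a | z \notin [:: tr b x; tr c y]]
      <= (f3 d + g a d)%R :: available f3 (Y :|: [set x in s]) a}.
    move=> z; rewrite mem_filter !inE negb_or -andbA => /and3P[zb zc zF].
    apply/norP => [[zd]]; apply/negP; rewrite negbK.
    move: zF; rewrite !mem_filter => /andP[zB zL]; rewrite zL andbT.
    apply: contra zB => /mapP[e]; rewrite mem_enum inE in_setU => /andP[+ ae zE].
    case/orP=> [eY|]; last first.
      rewrite inE => es; case: (eqVneq e d) => [ed|/(aS e es)]; last by rewrite ae.
      by rewrite zE ed eqxx in zd.
    move: zE; rewrite f3E //; case: (eqVneq e c) => [->|ec].
      by rewrite /f2 /recolor eqxx => /eqP; rewrite (negPf zc).
    case: (eqVneq e b) => [->|eb].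
      by rewrite /f2 /f1 /recolor eqxx (negPf nbc) => /eqP; rewrite (negPf zb).
    rewrite /f2 /f1 /recolor (negPf ec) (negPf eb) => ->; apply/mapP; exists e => //.
    by rewrite mem_enum inE ae andbT; move: eY; rewrite !in_setU1 (negPf ec) (negPf eb).
  have := uniq_leq_size (filter_uniq _ (fu a)) sub; rewrite /= => /(leq_trans save).
  by case: (available f3 _ a) => // z s' _; exists z; rewrite mem_head.
move=> zF; exists (recolor f3 a z).
have -> : X = a |: (Y :|: [set x in s]).
  apply/setP => e; rewrite !inE; case: (eqVneq e a) => [->|ea] //=.
  case: (eqVneq e c) => [->|ec] //=; case: (eqVneq e b) => [->|eb] //=.
  by case es: (e \in s) => //=; rewrite ?orbF // sX'.
apply: proper_on_recolor => //; rewrite in_setU negb_or aY /= inE //.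
Qed.
End ShiftColoring.

(** * Tight edges contain no cycle with an extra edge *)

Section Incidence.
Variables (V E : finType) (ends : E -> {set V}).
Hypothesis ends_inj : injective ends.
Hypothesis ends2 : forall e, #|ends e| = 2.

Definition share_end (e e' : E) := (e != e') && (ends e :&: ends e' != set0).

Definition star (X : {set E}) (v : V) := [set e in X | v \in ends e].

Definition deg (X : {set E}) (v : V) := #|star X v|.

Lemma share_end_sym : symmetric share_end.
Proof. by move=> e f; rewrite /share_end eq_sym setIC. Qed.

Lemma share_end_irr : irreflexive share_end.
Proof. by move=> e; rewrite /share_end eqxx. Qed.

Lemma share_endP e f v : v \in ends e -> v \in ends f -> e != f -> share_end e f.
Proof.
by rewrite /share_end => ve vf ->; apply/set0Pn; exists v; rewrite inE ve.
Qed.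

Lemma other_end e v : v \in ends e -> exists2 y, y != v & ends e = [set v; y].
Proof.
move=> ve; have /eqP/cards2P[x [y [xy Ee]]] := ends2 e.
move: ve; rewrite Ee !inE => /orP[]/eqP->; first by exists y => //; rewrite eq_sym.
by exists x => //; rewrite setUC.
Qed.

Lemma ends_pair e x y : x != y -> x \in ends e -> y \in ends e -> ends e = [set x; y].
Proof.
move=> xy xe ye; apply/eqP; rewrite eq_sym eqEcard ends2 cards2 xy andbT.
by apply/subsetP => z; rewrite !inE => /orP[]/eqP->.
Qed.

Lemma deg_share_end (X : {set E}) e x y : e \in X -> x != y -> ends e = [set x; y] ->
  #|nbrs share_end X e| + 2 = deg X x + deg X y.
Proof.
move=> eX xy Ee.
have EI : star X x :&: star X y = [set e].
  apply/setP=> f; rewrite !inE; apply/idP/eqP => [/andP[/andP[fX xf] /andP[_ yf]]|->].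
    by apply: ends_inj; rewrite Ee; apply: ends_pair.
  by rewrite eX Ee !inE !eqxx orbT.
have EU : star X x :|: star X y = e |: nbrs share_end X e.
  apply/setP=> f; rewrite !inE -andb_orr; case: (eqVneq f e) => [->|fe] /=.
    by rewrite eX Ee !inE eqxx.
  case: (f \in X) => //=; rewrite /share_end eq_sym fe /=.
  apply/idP/idP => [/orP[] vf|/set0Pn[z]].
  - by apply/set0Pn; exists x; rewrite inE vf Ee !inE eqxx.
  - by apply/set0Pn; exists y; rewrite inE vf Ee !inE eqxx orbT.
  by rewrite inE Ee !inE => /andP[/orP[]/eqP-> ->]; rewrite ?orbT.
have := cardsUI (star X x) (star X y); rewrite EI EU cards1 cardsU1 !inE share_end_irr andbF.
by rewrite /deg; lia.
Qed.

Lemma handshake (w : V -> nat) (X : {set E}) :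
  \sum_v w v * deg X v = \sum_(e in X) \sum_(v in ends e) w v.
Proof.
have -> : \sum_v w v * deg X v = \sum_v \sum_(e in X | v \in ends e) w v.
  by apply: eq_bigr => v _; rewrite sum_nat_const mulnC; congr (_ * _); apply: eq_card => e; rewrite !inE.
rewrite (exchange_big_dep [in X]) /= => [|v e _ /andP[] //].
by apply: eq_bigr => e eX; apply: eq_bigl => v; rewrite eX.
Qed.

Section Tight.
Variable T : {set E}.

Definition tadj x y := (x != y) && [exists e in T, ends e == [set x; y]].

Lemma tadj_sym : symmetric tadj.
Proof. by move=> x y; rewrite /tadj eq_sym setUC. Qed.

Lemma tadj_edge e x y : e \in T -> x != y -> ends e = [set x; y] -> tadj x y.
Proof. by move=> eT xy Ee; rewrite /tadj xy; apply/existsP; exists e; rewrite eT Ee /=. Qed.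

Hypothesis no_cycle_plus_edge : forall a b c s,
  uniq [:: a, b, c & s] -> {subset [:: a, b, c & s] <= T} ->
  s != [::] -> ~~ share_end b c -> share_end a b ->
  path share_end a (c :: s) -> share_end (last c s) a -> share_end (last c s) b ->
  {in s, forall e, e != last c s -> ~~ share_end a e} -> False.

(** A choice of edges for pairs of vertices turns vertex paths into edge paths
    by [pairmap]. *)
Lemma edge_choice : T != set0 ->
  exists ed : V -> V -> E, forall x y, tadj x y -> ed x y \in T /\ ends (ed x y) = [set x; y].
Proof.
move=> /set0Pn[e0 _].
exists (fun x y => odflt e0 [pick e in T | ends e == [set x; y]]) => x y /andP[_ /existsP[e He]].
by case: pickP => [f /andP[fT /eqP]|/(_ e)] //; rewrite He.
Qed.

Lemma pairmap_rcons (S U : Type) (f : S -> S -> U) x s y :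
  pairmap f x (rcons s y) = rcons (pairmap f x s) (f (last x s) y).
Proof. by rewrite -cats1 pairmap_cat cats1. Qed.

Section Edges.
Variable ed : V -> V -> E.
Hypothesis edP : forall x y, tadj x y -> ed x y \in T /\ ends (ed x y) = [set x; y].

Lemma pairmap_ends x p e : path tadj x p -> e \in pairmap ed x p ->
  e \in T /\ ends e \subset x :: p.
Proof.
elim: p x => //= y p IH x /andP[xy yp]; rewrite inE => /orP[/eqP->|/(IH y yp)[eT es]].
  have [eT ->] := edP xy; split=> //.
  by apply/subsetP => z; rewrite !inE => /orP[]->; rewrite ?orbT.
by split=> //; apply: subset_trans es _; apply/subsetP => z; rewrite !inE => ->; rewrite orbT.
Qed.

Lemma pairmap_uniq x p : path tadj x p -> uniq (x :: p) -> uniq (pairmap ed x p).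
Proof.
elim: p x => //= y p IH x /andP[xy yp] /and3P[xyp yP up].
rewrite IH ?yP //= andbT; apply/negP => /(pairmap_ends yp)[_].
by have [_ ->] := edP xy => /subsetP/(_ x); rewrite !inE eqxx => /(_ isT); rewrite -in_cons (negPf xyp).
Qed.

Lemma pairmap_path z x p : tadj z x -> path tadj x p -> uniq [:: z, x & p] ->
  path share_end (ed z x) (pairmap ed x p).
Proof.
elim: p z x => //= y p IH z x zx /andP[xy yp] /and4P[]; rewrite !inE !negb_or.
move=> /and3P[zx' zy zp] /andP[xy' xp] yP up; rewrite IH ?inE ?negb_or ?xy' ?xp ?yP ?andbT //.
have [_ E1] := edP zx; have [_ E2] := edP xy.
apply: (@share_endP _ _ x); rewrite ?E1 ?E2 ?inE ?eqxx ?orbT //.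
apply: contraNneq zx' => e12; have : z \in ends (ed z x) by rewrite E1 !inE eqxx.
by rewrite e12 E2 !inE (negPf zy) orbF.
Qed.

(** The extra edge v0 w avoids v2, so that b = v0 w and c = v1 v2 do not meet and
    the reducible configuration is found with a = v0 v1. *)
Lemma no_lollipop_generic v0 v1 v2 r w : cycle tadj [:: v0, v1, v2 & r] ->
  uniq [:: v0, v1, v2 & r] ->
  tadj v0 w -> w \notin [:: v1; v2; last v2 r] -> False.
Proof.
rewrite /= => /and3P[a01 a12 p] /and4P[]; rewrite !inE !negb_or => /and3P[n01 n02 n0r].
move=> /andP[n12 n1r] n2r ur a0w /and3P[wv1 wv2 wl].
have n0w : v0 != w by case/andP: a0w.
set s := pairmap ed v2 (rcons r v0).
have sl : last (ed v1 v2) s = ed (last v2 r) v0 by rewrite /s pairmap_rcons last_rcons.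
have [e01 E01] := edP a01; have [e12 E12] := edP a12; have [e0w E0w] := edP a0w.
have al : tadj (last v2 r) v0 by move: p; rewrite rcons_path => /andP[].
have [el El] := edP al.
have u2 : uniq (v2 :: rcons r v0).
  by rewrite /= mem_rcons inE rcons_uniq negb_or eq_sym n02 n2r n0r.
have sE e : e \in s -> e \in T /\ ends e \subset v2 :: rcons r v0 by exact: pairmap_ends.
have us : uniq s by apply: pairmap_uniq.
have n1s : v1 \notin v2 :: rcons r v0 by rewrite inE mem_rcons inE !negb_or n12 eq_sym n01.
have sN1 e : e \in s -> v1 \notin ends e.
  by move=> /sE[_ /subsetP sub]; apply: contra n1s => /sub.
have sN0 e : e \in s -> v0 \in ends e -> e = ed (last v2 r) v0.
  rewrite /s pairmap_rcons mem_rcons inE => /orP[/eqP //|].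
  move: p; rewrite rcons_path => /andP[p _] /(pairmap_ends p)[_ /subsetP sub /sub].
  by rewrite inE (negPf n02) (negPf n0r).
have nE e f v : v \in ends e -> v \notin ends f -> e != f.
  by move=> ve; apply: contraNneq => <-.
apply: (@no_cycle_plus_edge (ed v0 v1) (ed v0 w) (ed v1 v2) s).
- rewrite /= us andbT !inE !negb_or -!andbA; apply/and5P; split.
  + by apply: (@nE _ _ v1); rewrite ?E01 ?E0w ?inE ?eqxx ?orbT // negb_or eq_sym n01 eq_sym.
  + by apply: (@nE _ _ v0); rewrite ?E01 ?E12 ?inE ?eqxx ?orbT // negb_or n01.
  + by apply: contraT => /negPn/sN1; rewrite E01 !inE eqxx orbT.
  + by apply: (@nE _ _ v0); rewrite ?E0w ?E12 ?inE ?eqxx ?orbT // negb_or n01.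
  apply/andP; split; last by apply: contraT => /negPn/sN1; rewrite E12 !inE eqxx.
  apply/negP => ws; have := sN0 _ ws; rewrite E0w !inE eqxx => /(_ isT) ebl.
  have : w \in ends (ed v0 w) by rewrite E0w !inE eqxx orbT.
  by rewrite ebl El !inE (negPf wl) eq_sym (negPf n0w).
- move=> e; rewrite !inE => /or4P[/eqP->|/eqP->|/eqP->|/sE[]] //.
- by rewrite /s; case: (r).
- rewrite /share_end negb_and orbC negbK; apply/orP; left; rewrite -subset0.
  apply/subsetP => z; rewrite !inE E0w E12 !inE => /andP[/orP[]/eqP-> /orP[]/eqP Ez].
  + by rewrite Ez eqxx in n01.
  + by rewrite Ez eqxx in n02.
  + by rewrite Ez eqxx in wv1.
  + by rewrite Ez eqxx in wv2.
- apply: (@share_endP _ _ v0); rewrite ?E01 ?E0w ?inE ?eqxx //.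
  by apply: (@nE _ _ v1); rewrite ?E01 ?E0w ?inE ?eqxx ?orbT // negb_or eq_sym n01 eq_sym.
- apply/andP; split.
    apply: (@share_endP _ _ v1); rewrite ?E01 ?E12 ?inE ?eqxx ?orbT //.
    by apply: (@nE _ _ v0); rewrite ?E01 ?E12 ?inE ?eqxx ?orbT // negb_or n01.
  by apply: pairmap_path => //; rewrite cons_uniq u2 n1s.
- rewrite sl; apply: (@share_endP _ _ v0); rewrite ?E01 ?El ?inE ?eqxx ?orbT //.
  rewrite eq_sym; apply: (nE (ed v0 v1) (ed (last v2 r) v0) v1); rewrite ?E01 ?El ?inE ?eqxx ?orbT // negb_or [v1 == v0]eq_sym n01 andbT.
  by apply: contraNneq n1s => ->; rewrite -rcons_cons mem_rcons inE mem_last orbT.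
- rewrite sl; apply: (@share_endP _ _ v0); rewrite ?E0w ?El ?inE ?eqxx ?orbT //.
  rewrite eq_sym; apply: (nE (ed v0 w) (ed (last v2 r) v0) w); rewrite ?E0w ?El ?inE ?eqxx ?orbT // negb_or wl [w == v0]eq_sym //.
move=> e es; rewrite sl => el0; rewrite /share_end negb_and orbC negbK; apply/orP; left; rewrite -subset0.
apply/subsetP => z; rewrite !inE E01 !inE => /andP[/orP[]/eqP-> ve].
  by rewrite (sN0 e es ve) eqxx in el0.
by rewrite (negPf (sN1 e es)) in ve.
Qed.

(** If w = v2, the chord v0 v2 cuts off the triangle v2 v1 v0, and the next
    cycle edge v2 v3 is an extra edge attached to that triangle. *)
Lemma no_lollipop v0 v1 v2 r w : cycle tadj [:: v0, v1, v2 & r] ->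
  uniq [:: v0, v1, v2 & r] ->
  tadj v0 w -> w \notin [:: v1; last v2 r] -> False.
Proof.
move=> cy un a0w; rewrite !inE negb_or => /andP[wv1 wl].
case: (eqVneq w v2) => [wv2|wv2]; last first.
  by apply: (no_lollipop_generic cy un a0w); rewrite !inE !negb_or wv1 wv2.
case: r cy un wl => [|v3 r]; first by rewrite wv2 /= eqxx.
move=> /= /and4P[a01 a12 a23 _]; rewrite !inE !negb_or.
move=> /andP[/and4P[n01 n02 n03 _] /andP[/and3P[n12 n13 _] /andP[/andP[n23 _] _]]] _.
rewrite wv2 in a0w.
apply: (@no_lollipop_generic v2 v1 v0 [::] v3) => //=.
- by rewrite tadj_sym a12 tadj_sym a01 a0w.
- by rewrite !inE !negb_or eq_sym n12 eq_sym n02 eq_sym n01.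
by rewrite !inE !negb_or eq_sym n13 eq_sym n03.
Qed.
Lemma cycle_closed p v : cycle tadj p -> uniq p -> 2 < size p -> v \in p ->
  exists x y, [/\ x \in p, y \in p & forall w, tadj v w -> w \in [:: x; y]].
Proof.
move=> cp up sp vp; have [i q Eq] := rot_to vp.
have := rot_cycle i tadj p; rewrite cp; have := rot_uniq i p; rewrite up.
have := size_rot i p; have qp := mem_rot i p; rewrite Eq in qp *.
case: q qp {Eq} => [|v1 [|v2 r]] qp; try by move=> sz; rewrite -sz in sp.
move=> _ un cy; exists v1, (last v2 r); split.
- by rewrite -qp !inE eqxx orbT.
- by rewrite -qp 2!in_cons mem_last !orbT.
move=> w vw; apply: contraT => wN; exfalso; exact: no_lollipop cy un vw wN.
Qed.
End Edges.

Section Cycles.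
Variable W : {set V}.
Definition wadj x y := (x \in W) && (y \in W) && tadj x y.

(** Every vertex of W has a second neighbour, so a path can be prolonged at its
    head until the new neighbour of the head lies on the path. *)
Lemma cycle_exists (x : V) p :
  (forall x z, x \in W -> exists2 y, y != z & wadj x y) ->
  x \in W -> path wadj x p -> uniq (x :: p) ->
  exists q, [/\ cycle wadj q, uniq q & 2 < size q].
Proof.
move=> nbr; have [n] := ubnP (#|V| - size p); elim: n x p => // n IH x p lt xW px up.
have [y yp xy] := nbr x (head x p) xW.
have /andP[/andP[_ yW] /andP[nxy _]] := xy.
have yx : wadj y x by move: xy; rewrite /wadj tadj_sym -!andbA andbCA.
case: (boolP (y \in x :: p)) => [|yN]; last first.
  apply: (IH y (x :: p)); rewrite //= ?yx //; last by rewrite -cons_uniq cons_uniq yN.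
  have : size [:: y, x & p] <= #|V|.
    by rewrite -(card_uniqP _) ?max_card //; rewrite cons_uniq yN.
  by move: lt => /=; lia.
rewrite inE eq_sym (negPf nxy) /= => yin.
exists (x :: take (index y p).+1 p).
have Et : take (index y p).+1 p = rcons (take (index y p) p) y.
  by rewrite (take_nth y) ?index_mem // nth_index.
split.
- rewrite /= rcons_path Et last_rcons yx andbT -Et.
  by move: px; rewrite -{1}(cat_take_drop (index y p).+1 p) cat_path => /andP[].
- by move: up; rewrite -{1}(cat_take_drop (index y p).+1 p) -cat_cons cat_uniq => /andP[].
rewrite /= Et size_rcons size_take index_mem yin !ltnS lt0n.
by case: p yp yin {IH lt px up Et} => //= z p; rewrite eq_sym => /negPf->.
Qed.
End Cycles.

Definition inner (W : {set V}) := [set e in T | ends e \subset W].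

Lemma sum_deg (X : {set E}) : \sum_v deg X v = 2 * #|X|.
Proof.
have := handshake (fun=> 1) X; under eq_bigr do rewrite mul1n.
move=> ->; under eq_bigr do rewrite sum1_card ends2.
by rewrite sum_nat_const mulnC.
Qed.

(** A vertex spanning at most one of the edges can be removed from W, and if
    all degrees are at most 2 the bound is the handshake lemma. Otherwise the
    edges contain a cycle. No further edge is attached to it, so removing its
    vertices from W removes equally many edges. *)
Lemma card_inner (W : {set V}) : #|inner W| <= #|W|.
Proof.
have [n] := ubnP #|W|; elim: n W => // n IH W lt.
case: (eqVneq T set0) => [T0|/edge_choice[ed edP]].
  by rewrite (_ : inner W = set0) ?cards0 //; apply/setP => e; rewrite !inE T0 inE.
have degN v : v \notin W -> deg (inner W) v = 0.
  move=> vW; apply: eq_card0 => e; rewrite !inE; apply/negP => /andP[/andP[_ /subsetP/(_ v) H] /H].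
  by rewrite (negPf vW).
case: (boolP [exists v in W, deg (inner W) v <= 1]) => [/existsP[v /andP[vW dv]]|/existsPn min2].
  have : #|inner W| <= #|inner (W :\ v)| + deg (inner W) v.
    rewrite -(cardsID (star (inner W) v) (inner W)) addnC leq_add //; last first.
      by rewrite subset_leq_card // subsetIr.
    rewrite subset_leq_card //; apply/subsetP => e; rewrite !inE => /andP[+ /andP[eT eW]].
    by rewrite eT subsetD1 eW /= => ->.
  have := IH (W :\ v); rewrite (cardsD1 v W) vW in lt *; lia.
case: (boolP [forall v in W, deg (inner W) v <= 2]) => [/forallP max2|].
  have := sum_deg (inner W); rewrite (bigID [in W]) /= [X in _ + X]big1 => [|v /degN //].
  suff : \sum_(v in W) deg (inner W) v <= \sum_(v in W) 2 by rewrite sum_nat_const; lia.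
  by apply: leq_sum => v vW; have := max2 v; rewrite vW.
rewrite negb_forall => /existsP[x]; rewrite negb_imply => /andP[xW _].
have edge_at v e : e \in star (inner W) v -> exists2 y, wadj W v y & ends e = [set v; y].
  rewrite !inE => /andP[/andP[eT eW] ve]; have [y yv Ee] := other_end ve.
  exists y => //; rewrite /wadj (@tadj_edge e) // 1?eq_sym //.
  by rewrite !(subsetP eW) // Ee !inE eqxx ?orbT.
have nbr v z : v \in W -> exists2 y, y != z & wadj W v y.
  move=> vW; have := min2 v; rewrite vW -ltnNge => /card_gt1P[e [f [/edge_at[y vy Ee] /edge_at[y' vy' Ef] ef]]].
  case: (eqVneq y z) => [yz|]; last by exists y.
  exists y' => //; apply: contraNneq ef => y'z; apply/eqP/ends_inj.
  by rewrite Ee Ef yz y'z.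
have [||p [cp up sp]] := @cycle_exists W x [::] nbr xW => //.
pose P := [set v in p].
have ct : cycle tadj p by apply: sub_cycle cp => a b /andP[].
have PW v : v \in p -> v \in W.
  by move=> vp; have := next_cycle cp vp => /andP[/andP[]].
have closed v : v \in p -> exists x y, [/\ x \in p, y \in p & forall w, tadj v w -> w \in [:: x; y]].
  exact: cycle_closed edP p v ct up sp.
have degP v : v \in p -> deg (inner W) v <= 2.
  move=> vp; have [a [b [_ _ ab]]] := closed v vp.
  have : star (inner W) v \subset [set ed v a; ed v b].
    apply/subsetP => e /edge_at[y /andP[_ vy] Ee].
    have := ab y vy; rewrite !inE; have [_ E'] := edP _ _ vy.
    have -> : e = ed v y by apply: ends_inj; rewrite E'.
    by move=> /orP[]/eqP->; rewrite eqxx ?orbT.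
  by move/subset_leq_card => /leq_trans-> //; rewrite cards2; case: (_ == _).
have subP v e : v \in p -> e \in star (inner W) v -> ends e \subset P.
  move=> vp /edge_at[y /andP[_ vy] ->]; have [a [b [ap bp /(_ y vy)]]] := closed v vp.
  rewrite !inE => ab; apply/subsetP => z; rewrite !inE => /orP[]/eqP-> //.
  by case/orP: ab => /eqP->.
have PsW : P \subset W by apply/subsetP => v; rewrite inE => /PW.
have P0 : 0 < #|P| by rewrite cardsE (card_uniqP up); apply: leq_trans sp.
have IHD := IH (W :\: P); rewrite cardsD (setIidPr PsW) in IHD.
have PleW := subset_leq_card PsW.
have : #|inner W| <= #|inner (W :\: P)| + #|inner P|.
  rewrite -(cardsID (inner P) (inner W)) addnC leq_add //; last first.
    by rewrite subset_leq_card // subsetIr.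
  rewrite subset_leq_card //; apply/subsetP => e; rewrite !inE => /andP[+ /andP[eT eW]].
  rewrite eT subsetD eW /= => eP; apply/pred0P => v /=; apply/negP => /andP[ve].
  by rewrite inE => vp; move: eP; rewrite (subP v) // !inE eT eW.
have : #|inner P| <= #|P|; last by lia.
have dP v : deg (inner P) v <= deg (inner W) v.
  rewrite subset_leq_card //; apply/subsetP => e; rewrite !inE.
  by move=> /andP[/andP[-> eP] ->]; rewrite (subset_trans eP).
have := sum_deg (inner P); rewrite (bigID [in P]) /= [X in _ + X]big1 => [|v vP]; last first.
  apply: eq_card0 => e; rewrite !inE; apply/negP => /andP[/andP[_ /subsetP/(_ v) H] /H].
  by rewrite (negPf vP).
suff : \sum_(v in P) deg (inner P) v <= \sum_(v in P) 2 by rewrite sum_nat_const; lia.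
by apply: leq_sum => v; rewrite inE => /degP; apply: leq_trans.
Qed.
End Tight.
End Incidence.

(** * Even sets of edges *)

Section Parity.
Variable E : finType.
Implicit Types (z : {set E}) (f : E -> bool).

Definition parity z f := \big[addb/false]_(e in z) f e.

Definition symdiff z z' := [set e | (e \in z) (+) (e \in z')].

Lemma parityE z f : parity z f = \big[addb/false]_e ((e \in z) && f e).
Proof. by rewrite /parity big_mkcond; apply: eq_bigr => e _; case: (_ \in _). Qed.

Lemma eq_parity z f g : {in z, f =1 g} -> parity z f = parity z g.
Proof. by move=> fg; apply: eq_bigr => e /fg. Qed.

Lemma parityD z f g : parity z (fun e => f e (+) g e) = parity z f (+) parity z g.
Proof. exact: big_split. Qed.

Lemma parity_symdiff z z' f : parity (symdiff z z') f = parity z f (+) parity z' f.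
Proof.
rewrite !parityE -big_split; apply: eq_bigr => e _; rewrite inE.
by case: (e \in z); case: (e \in z'); case: (f e).
Qed.

Lemma parity1 z e : parity z (pred1 e) = (e \in z).
Proof.
rewrite parityE (bigD1 e) //= eqxx andbT big1 ?addbF // => f /negPf fe.
by rewrite fe andbF.
Qed.

Lemma parity_odd z (P : pred E) : parity z P = odd #|[set e in z | P e]|.
Proof.
rewrite parityE -sum1_card (big_morph odd oddD (erefl : odd 0 = false)) [RHS]big_mkcond.
by apply: eq_bigr => e _; rewrite inE; case: (_ && _).
Qed.

Lemma symdiffK z z' : symdiff (symdiff z z') z' = z.
Proof. by apply/setP => e; rewrite !inE addbK. Qed.
End Parity.

Section SmallEven.
Variables (V E : finType) (ends : E -> {set V}).
Hypothesis ends_inj : injective ends.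
Hypothesis ends2 : forall e, #|ends e| = 2.
Hypothesis noC4 : forall x y u w e1 e2 e3 e4, uniq [:: x; y; u; w] ->
  ends e1 = [set x; y] -> ends e2 = [set y; u] -> ends e3 = [set u; w] ->
  ends e4 = [set w; x] -> False.

Definition inc v e := v \in ends e.

Definition even_set z := forall v, parity z (inc v) = false.

Lemma even_deg z v : even_set z -> odd (deg ends z v) = false.
Proof. by move=> ez; rewrite -(ez v) parity_odd. Qed.

Lemma even_next z e x y : even_set z -> e \in z -> x != y -> ends e = [set x; y] ->
  exists w f, [/\ f \in z, ends f = [set y; w], w != y & w != x].
Proof.
move=> ez ez' xy Ee; have := even_deg y ez.
have es : e \in star ends z y by rewrite inE ez' Ee !inE eqxx orbT.
rewrite /deg (cardsD1 e) es add1n /= => /negbFE od.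
have /card_gt0P[f] : 0 < #|star ends z y :\ e| by case: #|_| od.
rewrite !inE => /andP[fe /andP[fz yf]]; have [w wy Ef] := other_end ends2 yf.
exists w, f; split=> //; apply: contraNneq fe => wx.
by apply/eqP/ends_inj; rewrite Ef Ee wx setUC.
Qed.

(** Walk from the edge xy along unused edges: y w, w u, and x t backwards. Either
    the walk closes up to a triangle, or it yields a path t x y w u, with t and u
    distinct as there are no 4-cycles, and a fifth edge at u. *)
Lemma even_set_at z e x y : even_set z -> e \in z -> x != y -> ends e = [set x; y] ->
  5 <= #|z| \/ exists w f g, [/\ f \in z, g \in z, ends f = [set y; w],
     ends g = [set w; x] & uniq [:: x; y; w]].
Proof.
move=> ez ez' xy Ee; have [w [f [fz Ef wy wx]]] := even_next ez ez' xy Ee.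
have yw : y != w by rewrite eq_sym.
have [u [g [gz Eg uw uy]]] := even_next ez fz yw Ef.
have tri g' : g' \in z -> ends g' = [set w; x] -> 5 <= #|z| \/ exists w f g, [/\ f \in z, g \in z, ends f = [set y; w],
     ends g = [set w; x] & uniq [:: x; y; w]].
  move=> gz' Eg'; right; exists w, f, g'; split=> //.
  by rewrite /= !inE negb_or xy eq_sym wx eq_sym wy.
case: (eqVneq u x) => [ux|ux]; first by apply: (tri g) => //; rewrite Eg ux.
have yx : y != x by rewrite eq_sym.
have [t [h [hz Eh tx ty]]] := even_next ez ez' yx (etrans Ee (setUC _ _)).
case: (eqVneq t w) => [tw|tw]; first by apply: (tri h) => //; rewrite Eh tw setUC.
case: (eqVneq t u) => [tu|tu].
  exfalso; apply: (@noC4 x y w u e f g h) => //; last by rewrite Eh tu setUC.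
  by rewrite /= !inE !negb_or xy yw ![x == _]eq_sym wx ux [y == u]eq_sym uy [w == u]eq_sym uw.
have wu : w != u by rewrite eq_sym.
have [q [k [kz Ek qu qw]]] := even_next ez gz wu Eg.
have sub : {subset [:: e; f; g; h; k] <= z} by apply/allP; rewrite /= ez' fz gz hz kz.
left; suff us : uniq [:: e; f; g; h; k].
  by rewrite cardE; apply: (uniq_leq_size us) => a /sub; rewrite mem_enum.
have nE v a b : v \in ends a -> v \notin ends b -> a != b.
  by move=> va; apply: contraNneq => <-.
have xw : x != w by rewrite eq_sym.
rewrite /= !inE !negb_or !andbT -!andbA; apply/and5P; split; last (apply/and5P; split; last apply/andP; last split).
- by apply: (nE x); rewrite ?Ee ?Ef !inE ?eqxx // negb_or xy.
- by apply: (nE x); rewrite ?Ee ?Eg !inE ?eqxx // negb_or xw eq_sym.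
- by apply: (nE y); rewrite ?Ee ?Eh !inE ?eqxx ?orbT // negb_or yx eq_sym.
- by rewrite eq_sym; apply: (nE u); rewrite ?Ee ?Ek !inE ?eqxx // negb_or ux.
- by apply: (nE y); rewrite ?Ef ?Eg !inE ?eqxx // negb_or yw eq_sym.
- by apply: (nE y); rewrite ?Ef ?Eh !inE ?eqxx // negb_or yx eq_sym.
- by rewrite eq_sym; apply: (nE u); rewrite ?Ef ?Ek !inE ?eqxx // negb_or uy.
- by apply: (nE w); rewrite ?Eg ?Eh !inE ?eqxx // negb_or wx eq_sym.
- by apply: (nE w); rewrite ?Eg ?Ek !inE ?eqxx // negb_or wu eq_sym.
by rewrite eq_sym; apply: (nE u); rewrite ?Eh ?Ek !inE ?eqxx // negb_or ux eq_sym.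
Qed.

(** A triangle and one more edge is not even. *)
Lemma even_card z : even_set z -> z != set0 -> #|z| = 3 \/ 5 <= #|z|.
Proof.
move=> ez /set0Pn[e ee]; have /eqP/cards2P[x [y [xy Ee]]] := ends2 e.
have [|[w [f [g [fz gz Ef Eg]]]]] := even_set_at ez ee xy Ee; first by right.
rewrite /= !inE negb_or => /and3P[/andP[_ xw] yw _].
have sub : [set e; f; g] \subset z.
  by apply/subsetP => a; rewrite !inE -orbA => /or3P[]/eqP->.
have ef : e != f.
  by apply/eqP => /(congr1 ends)/setP/(_ x); rewrite Ee Ef !inE eqxx (negPf xy) (negPf xw).
have eg : e != g.
  by apply/eqP => /(congr1 ends)/setP/(_ w); rewrite Ee Eg !inE eqxx ![w == _]eq_sym (negPf yw) (negPf xw).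
have fg : f != g.
  by apply/eqP => /(congr1 ends)/setP/(_ y); rewrite Eg Ef !inE eqxx (negPf yw) eq_sym (negPf xy).
have c3 : #|[set e; f; g]| = 3.
  by rewrite setUC cardsU1 !inE negb_or ![g == _]eq_sym eg fg cards2 ef.
have := subset_leq_card sub; rewrite c3 leq_eqVlt => /orP[/eqP<-|]; first by left.
rewrite leq_eqVlt => /orP[/eqP z4|]; last by right.
have : #|z :\: [set e; f; g]| = 1 by rewrite cardsD (setIidPr sub) c3 -z4.
move/eqP/cards1P => [h Eh]; have /eqP/cards2P[p [q [pq Ep]]] := ends2 h.
have := ez p; rewrite (_ : z = symdiff [set e; f; g] [set h]); last first.
  apply/setP => a; rewrite inE -Eh in_setD.
  by case: (boolP (a \in [set e; f; g])) => //= /(subsetP sub).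
rewrite parity_symdiff [X in _ (+) X]/parity big_set1 /inc Ep !inE eqxx /=.
rewrite /parity setUC big_setU1 /=; last by rewrite !inE negb_or ![g == _]eq_sym eg fg.
rewrite big_setU1 ?inE //= big_set1 /inc Ee Ef Eg !inE.
case: (eqVneq p x) => [->|_]; first by rewrite (negPf xy) (negPf xw).
case: (eqVneq p y) => [->|_]; first by rewrite (negPf yw).
by case: (p == w).
Qed.

(** Two triangles on a common edge form a 4-cycle. *)
Lemma triangle_unique z z' e : even_set z -> even_set z' -> #|z| = 3 -> #|z'| = 3 ->
  e \in z -> e \in z' -> z = z'.
Proof.
have /eqP/cards2P[x [y [xy Ee]]] := ends2 e.
have key z1 : even_set z1 -> #|z1| = 3 -> e \in z1 -> exists w f g, 
    [/\ z1 = [set e; f; g], ends f = [set y; w], ends g = [set w; x] & uniq [:: x; y; w]].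
  move=> ez z3 ee; have [|[w [f [g [fz gz Ef Eg u]]]]] := even_set_at ez ee xy Ee.
    by rewrite z3.
  exists w, f, g; split=> //; apply/eqP; rewrite eq_sym eqEcard z3.
  move: u; rewrite /= !inE negb_or => /and3P[/andP[_ xw] yw _].
  apply/andP; split; first by apply/subsetP => a; rewrite !inE -orbA => /or3P[]/eqP->.
  have ef : e != f.
    by apply/eqP => /(congr1 ends)/setP/(_ x); rewrite Ee Ef !inE eqxx (negPf xy) (negPf xw).
  have eg : e != g.
    by apply/eqP => /(congr1 ends)/setP/(_ w); rewrite Ee Eg !inE eqxx ![w == _]eq_sym (negPf yw) (negPf xw).
  have fg : f != g.
    by apply/eqP => /(congr1 ends)/setP/(_ y); rewrite Eg Ef !inE eqxx (negPf yw) eq_sym (negPf xy).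
  by rewrite setUC cardsU1 !inE negb_or ![g == _]eq_sym eg fg cards2 ef.
move=> ez ez' z3 z3' ee ee'.
have [w [f [g [-> Ef Eg u]]]] := key z ez z3 ee.
have [w' [f' [g' [-> Ef' Eg' u']]]] := key z' ez' z3' ee'.
case: (eqVneq w w') => [ww|ww].
  have -> : f = f' by apply: ends_inj; rewrite Ef Ef' ww.
  by have -> : g = g' by apply: ends_inj; rewrite Eg Eg' ww.
exfalso; apply: (@noC4 x w y w' g f f' g') => //; rewrite 1?setUC //.
move: u u'; rewrite /= !inE !negb_or => /and3P[/andP[_ xw] yw _] /and3P[/andP[_ xw'] yw' _].
by rewrite xw xy xw' eq_sym yw ww yw'.
Qed.
End SmallEven.

(** * Euler's inequality for a rotation system *)

Section Euler.
Variables (V E : finType) (ends : E -> {set V}).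
Hypothesis ends_inj : injective ends.
Hypothesis ends2 : forall e, #|ends e| = 2.
Hypothesis noC4 : forall x y u w e1 e2 e3 e4, uniq [:: x; y; u; w] ->
  ends e1 = [set x; y] -> ends e2 = [set y; u] -> ends e3 = [set u; w] ->
  ends e4 = [set w; x] -> False.
Variables (disp : Order.disp_t) (K : orderType disp).
Variables (X : {set E}) (c : V -> E -> bool) (key : V -> E -> K).
Hypothesis key_inj : forall v, {in star ends X v &, injective (key v)}.

Definition cycle_space := [set z : {set E} | (z \subset X) && [forall v, ~~ parity z (inc ends v)]].

Implicit Types z : {set E}.

Lemma cycle_spaceP z : reflect (z \subset X /\ even_set ends z) (z \in cycle_space).
Proof.
rewrite inE; apply: (iffP andP) => -[zX zev]; split=> //.
  by move=> v; apply/negbTE/(forallP zev).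
by apply/forallP => v; rewrite zev.
Qed.

(** For a rotation system in which the edges at v are ordered by [key v], this is
    the crossing parity of f, seen from a point in the sector just before e:
    [c v f] counts the crossings of f with a reference ray at v, and turning from
    that ray to e passes the edges at v that precede e. *)
Definition before v e f := c v f (+) (inc ends v f && (key v f < key v e)%O).

Hypothesis cert : forall e u v z, e \in X -> u \in ends e -> v \in ends e -> 
  z \in cycle_space -> e \notin z -> parity z (before u e) = parity z (before v e).

(** A function of even sets, cut off to false elsewhere so that functions
    agreeing on even sets are equal. *)
Definition functional (f : E -> bool) : {ffun {set E} -> bool} :=
  [ffun z : {set E} => (z \in cycle_space) && parity z f].

Lemma eq_functional f g : {in X, f =1 g} -> functional f = functional g.
Proof.
move=> fg; apply/ffunP => z; rewrite !ffunE; case: cycle_spaceP => //= -[zX _].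
by apply: eq_parity => e /(subsetP zX)/fg.
Qed.

(** The sector at v just before e, and for b = true the one just after e. *)
Definition sector v e b := functional (fun f => before v e f (+) (b && (f == e))).

Lemma sectorE v e b z : z \in cycle_space -> sector v e b z = parity z (before v e) (+) (b && (e \in z)).
Proof.
move=> zz; rewrite ffunE zz /= parityD; congr (_ (+) _).
case: b; last by rewrite /parity big1.
by rewrite -parity1; apply: eq_parity => f _; rewrite /= eq_sym.
Qed.

Lemma cycle_space_symdiff z z' : z \in cycle_space -> z' \in cycle_space -> symdiff z z' \in cycle_space.
Proof.
move=> /cycle_spaceP[zX ez] /cycle_spaceP[zX' ez']; apply/cycle_spaceP; split.
  apply/subsetP => e; rewrite inE; case: (boolP (e \in z)) => [/(subsetP zX) //|_].
  exact: (subsetP zX').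
by move=> v; rewrite parity_symdiff ez ez'.
Qed.

Lemma sector_out v e b z : z \notin cycle_space -> sector v e b z = false.
Proof. by move=> zz; rewrite ffunE (negPf zz). Qed.

(** The sectors before e at its two ends agree on even sets that avoid e, so
    their sum is linear and vanishes there: it is 0 or membership of e. The two
    ends see the same pair of sides, in the same or in the opposite order. *)
Lemma sides_agree e u v : e \in X -> u \in ends e -> v \in ends e ->
  (forall b, sector u e b = sector v e b) \/ (forall b, sector u e b = sector v e (~~ b)).
Proof.
move=> eX ue ve; pose D z := parity z (before u e) (+) parity z (before v e).
have D0 z : z \in cycle_space -> e \notin z -> D z = false.
  by move=> zz ez; rewrite /D (cert eX ue ve) // addbb.
case: (boolP [forall z in cycle_space, ~~ D z]) => [/forallP Dz|].
  left=> b; apply/ffunP => z; case: (boolP (z \in cycle_space)) => zz; last by rewrite !sector_out.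
  by rewrite !sectorE //; have := Dz z; rewrite zz /D; case: (parity z _); case: (parity z _).
rewrite negb_forall => /existsP[z0]; rewrite negb_imply negbK => /andP[zz0 Dz0].
have ez0 : e \in z0 by apply: contraTT Dz0 => /D0->.
right=> b; apply/ffunP => z; case: (boolP (z \in cycle_space)) => zz; last by rewrite !sector_out.
have DE : D z = (e \in z).
  case: (boolP (e \in z)) => ez; last by rewrite D0.
  have := D0 _ (cycle_space_symdiff zz zz0); rewrite inE ez ez0 => /(_ isT).
  move: Dz0; rewrite /D !parity_symdiff.
  by case: (parity z (before u e)); case: (parity z0 (before u e));
     case: (parity z (before v e)); case: (parity z0 (before v e)).
rewrite !sectorE //; move: DE; rewrite /D.
by case: (parity z _); case: (parity z _); case: (e \in z); case: b.
Qed.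

Definition nonbridge := [set e in X | [exists z in cycle_space, e \in z]].
Local Notation N := nonbridge.

Lemma sector_eq v e : (sector v e false == sector v e true) = ~~ [exists z in cycle_space, e \in z].
Proof.
apply/eqP/idP => [eq|/existsPn no].
  apply/existsPn => z; apply/negP => /andP[zz ez].
  by move/ffunP/(_ z): eq; rewrite !sectorE // ez; case: (parity _ _).
apply/ffunP => z; case: (boolP (z \in cycle_space)) => zz; last by rewrite !sector_out.
by rewrite !sectorE //; have := no z; rewrite zz /= => /negPf->.
Qed.

Definition is_side phi e := [exists v in ends e, (sector v e false == phi) || (sector v e true == phi)].

Lemma is_sideE phi e v : e \in X -> v \in ends e ->
  is_side phi e = (sector v e false == phi) || (sector v e true == phi).
Proof.
move=> eX ve; apply/existsP/idP => [[u /andP[ue]]|H]; last by exists v; rewrite ve.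
by case: (sides_agree eX ue ve) => H; rewrite !H // orbC.
Qed.

(** Sorting the edges at v, the sector after an edge is the one before the next
    edge. The sequence closes up because z has even degree at v. *)
Lemma sectors_around v : exists (s : seq E) (psi : nat -> {ffun {set E} -> bool}),
  [/\ uniq s, s =i star ends X v, psi 0 = psi (size s) &
   forall i e0, i < size s -> 
     sector v (nth e0 s i) false = psi i /\ sector v (nth e0 s i) true = psi i.+1].
Proof.
pose s := sort (fun e f => (key v e <= key v f)%O) (enum (star ends X v)).
pose psi i := functional (fun f => c v f (+) (f \in take i s)).
have ms : s =i star ends X v by move=> e; rewrite mem_sort mem_enum.
have us : uniq s by rewrite sort_uniq enum_uniq.
have ks : sorted <%O (map (key v) s).
  rewrite lt_sorted_uniq_le map_inj_in_uniq ?us //=; last first.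
    by move=> e f; rewrite !ms; apply: key_inj.
  rewrite sorted_map; apply: sort_sorted => e f; exact: le_total.
have lt_idx i e0 f : i < size s -> f \in s -> 
    (key v f < key v (nth e0 s i))%O = (index f s < i).
  move=> lti fs; rewrite -{1}(nth_index e0 fs) -!(nth_map _ (key v e0) (key v)) ?index_mem //.
  by rewrite lt_sorted_ltn_nth // !inE size_map ?index_mem.
have sdF i e0 : i < size s -> sector v (nth e0 s i) false = psi i.
  move=> lti; apply: eq_functional => f fX; rewrite addbF /before; congr (_ (+) _).
  case: (boolP (inc ends v f)) => vf /=.
    by have fs : f \in s; rewrite ?ms ?inE ?fX // lt_idx // in_take.
  by apply/esym/negbTE; apply: contra vf => /mem_take; rewrite ms inE => /andP[].
exists s, psi; split=> //.
  apply/ffunP => z; rewrite !ffunE; case: cycle_spaceP => //= -[zX ez]; rewrite !parityD.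
  congr (_ (+) _); rewrite take0 take_size [LHS]/parity big1 // -(ez v).
  by apply: eq_parity => f fz; rewrite ms inE (subsetP zX).
move=> i e0 lti; split; first exact: sdF.
have := sdF i e0 lti; move=> /ffunP sF.
apply/ffunP => z; case: (boolP (z \in cycle_space)) => zz; last by rewrite sector_out // ffunE (negPf zz).
have := sF z; rewrite !sectorE //= addbF => ->; rewrite !ffunE zz /= -parity1 -parityD.
apply: eq_parity => f _; rewrite -addbA (take_nth e0 lti) mem_rcons inE /=; congr (_ (+) _).
case: eqP => [->|_]; last by rewrite addbF.
by rewrite in_take ?mem_nth // index_uniq // ltnn.
Qed.

Lemma telescope (f : nat -> bool) n :
  \big[addb/false]_(i < n) (f i (+) f i.+1) = f 0 (+) f n.
Proof.
elim: n => [|n IH]; first by rewrite big_ord0 addbb.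
by rewrite big_ord_recr /= IH; case: (f 0); case: (f n); case: (f n.+1).
Qed.

(** The sectors around v form a closed sequence, and along it any property is
    gained as often as it is lost. *)
Lemma star_sides_even v (Q : pred {ffun {set E} -> bool}) :
  \big[addb/false]_(e in star ends X v) (Q (sector v e false) (+) Q (sector v e true)) = false.
Proof.
have [s [psi [us ms psi0 Hs]]] := sectors_around v.
rewrite (eq_bigl [in s]) => [|e]; last by rewrite ms.
rewrite -big_uniq //=; case: s us ms psi0 Hs => [|e0 s] us ms psi0 Hs; first by rewrite big_nil.
rewrite (big_nth e0) big_mkord.
rewrite (eq_bigr (fun i : 'I__ => Q (psi i) (+) Q (psi i.+1))) => [|i _].
  by rewrite (telescope (Q \o psi)) /= psi0 addbb.
by have [-> ->] := Hs i e0 (ltn_ord i).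
Qed.

Lemma star_sides_const v (Q : pred {ffun {set E} -> bool}) :
  {in star ends X v, forall e, Q (sector v e false) = Q (sector v e true)} ->
  {in star ends X v &, forall e f, Q (sector v e false) = Q (sector v f false)}.
Proof.
have [s [psi [us ms _ Hs]]] := sectors_around v => H.
have const i : i < size s -> Q (psi i) = Q (psi 0).
  elim: i => // i IH lti; rewrite -IH; last exact: ltnW.
  case: (s) ms Hs lti => // e0 s' ms Hs lti.
  have [<- _] := Hs i e0 (ltnW lti); have [_ <-] := Hs i e0 (ltnW lti).
  by rewrite -H // -ms mem_nth // ltnW.
suff cst e : e \in star ends X v -> Q (sector v e false) = Q (psi 0).
  by move=> e f /cst-> /cst->.
rewrite -ms => es; have := Hs _ e; rewrite -index_mem in es => /(_ _ es)[+ _].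
by rewrite nth_index -?index_mem // => ->; rewrite const.
Qed.

Definition faces := [set phi | [exists e in N, is_side phi e]].
Definition boundary phi := [set e in N | is_side phi e].

Lemma nonbridge_sub : N \subset X.
Proof. by apply/subsetP => e; rewrite inE => /andP[]. Qed.

(** Going around a vertex, the given face is entered as often as it is left. *)
Lemma boundary_even phi : even_set ends (boundary phi).
Proof.
move=> v; have := star_sides_even v (pred1 phi) => <-.
rewrite parityE [RHS]big_mkcond; apply: eq_bigr => e _.
rewrite !inE /inc; case: (boolP (e \in X)) => eX //=.
case: (boolP (v \in ends e)) => ve; rewrite ?andbF //= andbT (is_sideE _ eX ve).
have := sector_eq v e; case: [exists z in _, _] => /=; last by move=> /eqP->; rewrite addbb.
by move=> ne; case: (eqVneq (sector v e false) phi) => [<-|_] //=; rewrite eq_sym ne.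
Qed.

Lemma card_sides e : e \in N -> #|[set phi in faces | is_side phi e]| = 2.
Proof.
move=> eN; have eX := subsetP nonbridge_sub _ eN.
have /card_gt0P[v ve] : 0 < #|ends e| by rewrite ends2.
have -> : [set phi in faces | is_side phi e] = [set sector v e false; sector v e true].
  apply/setP => phi; rewrite !inE (is_sideE _ eX ve) ![phi == _]eq_sym; apply: andb_idl => H.
  by apply/existsP; exists e; rewrite eN (is_sideE _ eX ve).
by rewrite cards2 sector_eq negbK; move: eN; rewrite inE => /andP[_ ->].
Qed.

Lemma boundary_neq0 phi : phi \in faces -> boundary phi != set0.
Proof.
by rewrite inE => /existsP[e /andP[eN se]]; apply/set0Pn; exists e; rewrite inE eN.
Qed.

(** Each even set z is determined by the sums phi z + phi0 z over faces phi, for a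
    fixed face phi0: an edge belongs to z exactly if its two sides differ at z. *)
Lemma card_cycle_space_le : #|cycle_space| <= 2 ^ #|faces|.-1.
Proof.
have inj z z' : z \in cycle_space -> z' \in cycle_space -> 
    (forall phi psi, phi \in faces -> psi \in faces -> phi z (+) psi z = phi z' (+) psi z') -> z = z'.
  move=> zz zz' H; apply/setP => e; case: (boolP (e \in N)) => eN; last first.
    have out z1 : z1 \in cycle_space -> e \in z1 = false.
      move=> zz1; apply: contraNF eN => ez; rewrite inE; apply/andP; split.
        by have /cycle_spaceP[/subsetP->] := zz1.
      by apply/existsP; exists z1; rewrite zz1.
    by rewrite !out.
  have eX := subsetP nonbridge_sub _ eN; have /card_gt0P[v ve] : 0 < #|ends e| by rewrite ends2.
  have inPhi b : sector v e b \in faces.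
    rewrite inE; apply/existsP; exists e; rewrite eN (is_sideE _ eX ve).
    by case: b; rewrite eqxx ?orbT.
  have := H _ _ (inPhi false) (inPhi true); rewrite !sectorE //=.
  by rewrite !addbF !addKb.
case: (eqVneq faces set0) => [P0|/set0Pn[phi0 phi0P]].
  rewrite P0 cards0 expn0; apply/card_le1P => z zz z'; rewrite [RHS]inE.
  apply/idP/eqP => [zz'|-> //]; apply: inj => // phi psi; by rewrite P0 inE.
pose F z := [set phi in faces :\ phi0 | phi z (+) phi0 z].
rewrite (cardsD1 phi0) phi0P /= -card_powerset -(@card_in_imset _ _ F) => [|z z' zz zz' FE].
  apply: subset_leq_card; apply/subsetP => _ /imsetP[z _ ->]; rewrite inE.
  by apply/subsetP => phi; rewrite inE => /andP[].
apply: inj => // phi psi phiP psiP.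
have FP chi : chi \in faces -> chi z (+) phi0 z = chi z' (+) phi0 z'.
  case: (eqVneq chi phi0) => [->|ne] chiP; first by rewrite !addbb.
  by move/setP/(_ chi): FE; rewrite !inE ne; move: chiP; rewrite inE => ->.
have := FP _ phiP; have := FP _ psiP.
by case: (phi z); case: (psi z); case: (phi0 z); case: (phi z'); case: (psi z'); case: (phi0 z').
Qed.

Definition covered := [set v | 0 < deg ends X v].

(** Sets of edges with the same odd-degree vertices differ by an even set. As
    the number of odd-degree vertices is even, one vertex v0 can be left out in
    recording them, which leaves 2 ^ (|V| - 1) classes. *)
Lemma card_cycle_space_ge : X != set0 -> 2 ^ #|X| <= #|cycle_space| * 2 ^ #|covered|.-1.
Proof.
move=> /set0Pn[e0 e0X]; have /card_gt0P[v0 ve0] : 0 < #|ends e0| by rewrite ends2.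
have v0X : v0 \in covered by rewrite inE card_gt0; apply/set0Pn; exists e0; rewrite inE e0X.
pose B z := [set v | parity z (inc ends v)].
have BX z : z \subset X -> B z \subset covered.
  move=> zX; apply/subsetP => v; rewrite !inE parity_odd => od.
  suff : 0 < #|[set e in z | inc ends v e]|.
    move/leq_trans; apply; apply: subset_leq_card; apply/subsetP => e.
    by rewrite !inE => /andP[ez ve]; rewrite (subsetP zX).
  by case: #|_| od.
have Beven z : \big[addb/false]_v (v \in B z) = false.
  rewrite (eq_bigr (fun v => \big[addb/false]_(e in z) inc ends v e)) => [|v _]; last by rewrite inE.
  rewrite exchange_big big1 //= => e _.
  have -> : \big[addb/false]_v (inc ends v e) = parity [set: V] (fun v => inc ends v e).
    by rewrite parityE; apply: eq_bigr => v _; rewrite inE.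
  by rewrite parity_odd (_ : [set _ in _ | _] = ends e) ?ends2 //; apply/setP => v; rewrite !inE.
have BE z z' : B z :\ v0 = B z' :\ v0 -> B z = B z'.
  move=> eqB; have out v : v != v0 -> (v \in B z) = (v \in B z').
    by move=> ne; move/setP/(_ v): eqB; rewrite !in_setD1 ne.
  apply/setP => v; case: (eqVneq v v0) => [->|]; last exact: out.
  have := Beven z; have := Beven z'; rewrite (bigD1 v0) //= [in X in _ -> X](bigD1 v0) //=.
  rewrite (eq_bigr (fun v => v \in B z)) => [|w /out //].
  by case: (v0 \in B z); case: (v0 \in B z'); case: (\big[_/_]_(_ | _) _).
pose rep (y : {set V}) := odflt set0 [pick z in powerset X | B z :\ v0 == y].
pose F z := (symdiff z (rep (B z :\ v0)), B z :\ v0).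
have repP z : z \in powerset X -> rep (B z :\ v0) \in powerset X /\ B (rep (B z :\ v0)) = B z.
  move=> zX; rewrite /rep; case: pickP => [z' /andP[z'X /eqP/BE]|/(_ z)] //=.
  by rewrite zX eqxx.
rewrite -card_powerset (cardsD1 v0 covered) v0X /= -[in X in _ <= X]card_powerset -cardsX.
rewrite -(@card_in_imset _ _ F) => [|z z' _ _ [Es EB]]; last first.
  by rewrite EB in Es; rewrite -(symdiffK z (rep (B z' :\ v0))) Es symdiffK.
apply: subset_leq_card; apply/subsetP => _ /imsetP[z zX ->]; rewrite inE /=.
have [rX EB] := repP z zX; rewrite !powersetE in rX zX *.
apply/andP; split; last by apply: setSD; apply: BX.
apply/cycle_spaceP; split.
  apply/subsetP => e; rewrite inE; case: (boolP (e \in z)) => [/(subsetP zX) //|_].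
  exact: (subsetP rX).
move=> v; rewrite parity_symdiff; move/setP/(_ v): EB; rewrite !inE => ->.
exact: addbb.
Qed.

Lemma euler_faces : X != set0 -> #|X| <= #|faces|.-1 + #|covered|.-1.
Proof.
move=> /card_cycle_space_ge H; rewrite -(@leq_exp2l 2) // expnD.
by apply: leq_trans H _; rewrite leq_mul2r card_cycle_space_le orbT.
Qed.

Definition triangular_faces := [set phi in faces | #|boundary phi| == 3].

Lemma sum_boundary (A : {set {ffun {set E} -> bool}}) (S : {set E}) : S \subset N ->
  \sum_(phi in A) #|[set e in S | is_side phi e]| = \sum_(e in S) #|[set phi in A | is_side phi e]|.
Proof.
move=> SN; rewrite (eq_bigr (fun phi => \sum_(e in S | is_side phi e) 1)) => [|phi _]; last first.
  by rewrite sum1_card; apply: eq_card => e; rewrite !inE.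
rewrite (exchange_big_dep [in S]) /= => [|phi e _ /andP[] //].
by apply: eq_bigr => e eS; rewrite sum1_card; apply: eq_card => phi; rewrite !inE eS.
Qed.

(** Each edge that is not a bridge borders two faces, and each face has three or
    at least five such edges. *)
Lemma face_count : 5 * #|faces| <= 2 * #|N| + 2 * #|triangular_faces|.
Proof.
have := sum_boundary faces (subxx N); rewrite (eq_bigr (fun=> 2) (@card_sides)) sum_nat_const.
rewrite mulnC => <-.
have -> : 2 * #|triangular_faces| = \sum_(phi in faces) if #|boundary phi| == 3 then 2 else 0.
  rewrite -big_mkcondr sum_nat_const mulnC; congr (_ * _).
  by apply: eq_card => phi; rewrite in_set.
rewrite -big_split mulnC -sum_nat_const /=; apply: leq_sum => phi phiP.
rewrite -/(boundary phi); have := even_card ends_inj ends2 noC4 (boundary_even phi) (boundary_neq0 phiP).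
by case=> [->|] //; case: eqP => [->|] //; rewrite addn0.
Qed.

Hypothesis deg3 : forall v, v \in covered -> 2 < deg ends X v.

(** In general the triangular faces at v have disjoint pairs of edges there. The
    exception is a triangle which is the boundary of two faces; then it contains
    all edges at v that are not bridges, and v, of degree at least 3, has a
    bridge to pay for the second face. *)
Lemma triangle_faces_at v : \sum_(phi in triangular_faces) deg ends (boundary phi) v <= 
  2 * (deg ends X v)./2 + 2 * deg ends (X :\: N) v.
Proof.
have degE : deg ends X v = deg ends N v + deg ends (X :\: N) v.
  rewrite /deg -(cardsID N (star ends X v)); congr (_ + _); apply: eq_card => e.
    by rewrite !inE; case: (e \in X); rewrite //= andbC.
  by rewrite !in_set; case: (e \in X); rewrite ?andbF ?andbT //= ; case: (boolP (v \in ends e)); rewrite ?andbF ?andbT.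
have sE phi : deg ends (boundary phi) v = #|[set e in star ends N v | is_side phi e]|.
  by rewrite /deg; apply: eq_card => e; rewrite !in_set andbAC.
have sNN : star ends N v \subset N by apply/subsetP => e; rewrite inE => /andP[].
have mE : \sum_(phi in triangular_faces) deg ends (boundary phi) v = 
    \sum_(e in star ends N v) #|[set phi in triangular_faces | is_side phi e]|.
  by rewrite (eq_bigr _ (fun phi _ => sE phi)) sum_boundary.
have m_even : odd (\sum_(phi in triangular_faces) deg ends (boundary phi) v) = false.
  rewrite (big_morph odd oddD (erefl : odd 0 = false)) big1 // => phi _.
  by apply: even_deg; apply: boundary_even.
case: (boolP [forall e in star ends N v, #|[set phi in triangular_faces | is_side phi e]| <= 1]) => [/forallP le1|].
  have : \sum_(phi in triangular_faces) deg ends (boundary phi) v <= deg ends N v.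
    rewrite mE /deg -sum1_card; apply: leq_sum => e eN; have := le1 e; by rewrite eN.
  by lia.
rewrite negb_forall => /existsP[e]; rewrite negb_imply -ltnNge => /andP[eS].
move=> /card_gt1P[phi [psi [phiP psiP ne]]].
move: phiP psiP; rewrite !in_set => /andP[/andP[_ /eqP phi3] phie] /andP[/andP[_ /eqP psi3] psie].
have [eN ve] : e \in N /\ v \in ends e by move: eS; rewrite [_ \in star _ _ _]inE => /andP.
have bdE : boundary phi = boundary psi.
  apply: (triangle_unique ends_inj ends2 noC4 (boundary_even phi) (boundary_even psi) phi3 psi3 (e := e));
    by rewrite inE eN.
(* Crossing an edge of the common boundary exchanges phi and psi, and no other
   non-bridge borders either face; hence all sectors at v belong to phi or psi. *)
pose Q := [pred chi | (chi == phi) || (chi == psi)].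
have both f : f \in star ends X v -> f \in boundary phi -> Q (sector v f false) /\ Q (sector v f true).
  rewrite inE => /andP[fX vf]; rewrite [f \in boundary phi](_ : _ = (f \in boundary phi) && (f \in boundary psi)); last first.
    by rewrite bdE andbb.
  rewrite !in_set => /andP[/andP[/andP[_ fN] +] /andP[_ +]]; rewrite !(is_sideE _ fX vf) /=.
  by move: ne => /[swap] /orP[]/eqP<- /[swap] /orP[]/eqP<-; rewrite ?eqxx ?orbT.
have sideQ f chi : Q chi -> is_side chi f -> f \in N -> f \in boundary phi.
  by move=> /orP[]/eqP-> sf fN; last rewrite bdE; rewrite in_set fN.
have constQ : {in star ends X v, forall f, Q (sector v f false) = Q (sector v f true)}.
  move=> f fS; have [fX vf] : f \in X /\ v \in ends f by move: fS; rewrite inE => /andP.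
  case: (boolP (f \in boundary phi)) => [/(both f fS)[-> ->] //|fbd].
  have := sector_eq v f; case ex: [exists z in cycle_space, f \in z]; last by move=> /eqP->.
  have fN : f \in N by rewrite in_set fX ex.
  move=> _; apply/idP/idP => /sideQ sQ; rewrite sQ // ?(is_sideE _ fX vf) ?eqxx ?orbT // in fbd.
have NS f : f \in star ends N v -> f \in star ends X v.
  by rewrite !in_set => /andP[/andP[-> _] ->].
have Nbd f : f \in star ends N v -> f \in boundary phi.
  move=> fS; have [fN vf] : f \in N /\ v \in ends f by move: fS; rewrite [_ \in star _ _ _]inE => /andP.
  have ebd : e \in boundary phi by rewrite inE eN.
  have := star_sides_const constQ (NS e eS) (NS f fS).
  have [-> _] := both e (NS e eS) ebd => /esym Qf.
  by apply: (sideQ f _ Qf); rewrite // (is_sideE _ (subsetP nonbridge_sub _ fN) vf) eqxx.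
have dN : deg ends N v = deg ends (boundary phi) v.
  rewrite /deg; apply: eq_card => f; apply/idP/idP; last by rewrite !in_set => /andP[/andP[-> _] ->].
  by move=> fS; rewrite inE Nbd //; move: fS; rewrite !in_set => /andP[].
have dN_even : odd (deg ends N v) = false by rewrite dN; apply: even_deg; apply: boundary_even.
have dN3 : deg ends N v <= 3.
  by rewrite dN -phi3 subset_leq_card //; apply/subsetP => f; rewrite inE => /andP[].
have m4 : \sum_(chi in triangular_faces) deg ends (boundary chi) v <= 2 * deg ends N v.
  rewrite mE /deg mulnC -sum_nat_const; apply: leq_sum => f fS.
  rewrite -(@card_sides f); last exact: (subsetP sNN).
  by apply: subset_leq_card; apply/subsetP => chi; rewrite !in_set => /andP[/andP[-> _] ->].
have /deg3 d3 : v \in covered.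
  by rewrite inE /deg card_gt0; apply/set0Pn; exists e; apply: NS.
by move: m4 d3 dN3 dN_even degE; clear; lia.
Qed.

(** Euler's inequality combined with 5 |F| <= 2 |N| + 2 |F3|, for N the
    non-bridges and F3 the triangular faces, and with the bound on F3 obtained by
    summing [triangle_faces_at]. The bridges cancel. *)
Lemma euler_bound : X != set0 ->
  15 * #|X| + 30 <= 15 * #|covered| + 6 * #|X| + \sum_v 2 * (deg ends X v)./2.
Proof.
move=> X0; have F := euler_faces X0.
have VX0 : 0 < #|covered|.
  have /set0Pn[e eX] := X0; have /card_gt0P[v ve] : 0 < #|ends e| by rewrite ends2.
  by apply/card_gt0P; exists v; rewrite inE card_gt0; apply/set0Pn; exists e; rewrite inE eX.
have XV : 3 * #|covered| <= 2 * #|X|.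
  rewrite -(sum_deg ends2 X) [X in _ <= X](bigID [in covered]) /= mulnC -sum_nat_const.
  by apply: leq_trans (leq_addr _ _); apply: leq_sum => v /deg3.
have Phi0 : 0 < #|faces| by case: #|faces| F => //=; lia.
have cN : #|X| = #|N| + #|X :\: N|.
  by rewrite -(cardsID N X) (setIidPr nonbridge_sub).
have t3 : 6 * #|triangular_faces| <= \sum_v 2 * (deg ends X v)./2 + 4 * #|X :\: N|.
  have -> : 6 * #|triangular_faces| = \sum_v \sum_(phi in triangular_faces) deg ends (boundary phi) v.
    rewrite exchange_big /= mulnC -sum_nat_const; apply: eq_bigr => phi.
    by rewrite in_set sum_deg // => /andP[_ /eqP->].
  have -> : 4 * #|X :\: N| = \sum_v 2 * deg ends (X :\: N) v.
    by rewrite -big_distrr /= sum_deg // mulnA.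
  by rewrite -big_split; apply: leq_sum => v _; apply: triangle_faces_at.
by have := face_count; move: F VX0 Phi0 cN t3; clear; lia.
Qed.
End Euler.

(** * Counting tight edges against the Euler bound *)

Section Counting.
Variables (V E : finType) (ends : E -> {set V}).
Hypothesis ends_inj : injective ends.
Hypothesis ends2 : forall e, #|ends e| = 2.
Variables (X : {set E}) (D : nat).
Hypothesis D5 : 5 <= D.
Hypothesis degD : forall v, deg ends X v <= D.
Hypothesis heavy : forall e x y, e \in X -> x != y -> ends e = [set x; y] ->
  D + 3 <= deg ends X x + deg ends X y.
Local Notation d v := (deg ends X v).
Local Notation VX := (covered ends X).
Definition tight := [set e in X | #|nbrs (share_end ends) X e| <= D.+1].
Hypothesis sparse : forall W : {set V}, #|inner ends tight W| <= #|W|.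

Lemma deg_ge3 v : v \in VX -> 3 <= d v.
Proof.
rewrite inE => /card_gt0P[e]; rewrite inE => /andP[eX ve].
have [y yv Ee] := other_end ends2 ve.
by have := heavy eX (_ : v != y) Ee; rewrite eq_sym => /(_ yv); have := degD y; clear; lia.
Qed.

Lemma tightE e x y : e \in X -> x != y -> ends e = [set x; y] ->
  (e \in tight) = (d x + d y <= D + 3).
Proof.
move=> eX xy Ee; rewrite inE eX /=; have := deg_share_end ends_inj ends2 eX xy Ee.
by move=> <-; apply/idP/idP; clear; lia.
Qed.

(** Weighted degree sums are sums over edges of the weights of the two ends, so
    inequalities that hold edge by edge can be added up. *)
Lemma sum_over_ends (w w' : V -> nat) (r : E -> nat) :
  (forall e x y, e \in X -> x != y -> ends e = [set x; y] -> w x + w y <= w' x + w' y + r e) ->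
  \sum_(v in VX) w v * d v <= \sum_(v in VX) w' v * d v + \sum_(e in X) r e.
Proof.
move=> H.
have red (u : V -> nat) : \sum_(v in VX) u v * d v = \sum_(e in X) \sum_(v in ends e) u v.
  rewrite -handshake [RHS](bigID [in VX]) /= [X in _ = _ + X]big1 ?addn0 // => v.
  by rewrite inE -eqn0Ngt => /eqP->; rewrite muln0.
rewrite !red -big_split; apply: leq_sum => e eX.
have /eqP/cards2P[x [y [xy Ee]]] := ends2 e.
by rewrite Ee !big_setU1 ?inE //= !big_set1; apply: H Ee.
Qed.

(** For D >= 6 no edge joins two vertices of degree at most 4, and the edges at
    vertices of degree 3 are tight and lead to vertices of degree D. For D = 5
    there are also tight edges between vertices of degree 4; a single count of
    all tight edges then suffices. *)
Lemma euler_bound_fails : \sum_(v in VX) 9 * d v + 60 <= \sum_(v in VX) (30 + 4 * (d v)./2) -> False.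
Proof.
have tX : tight \subset X by apply/subsetP => e; rewrite inE => /andP[].
case: (ltnP 5 D) => [D6|D5'].
  (* The edges at vertices of degree 3 are tight edges spanned by W. *)
  pose W := [set v in VX | (d v == 3) || (d v == D)].
  have S1 : \sum_(v in VX) (d v <= 4) * d v <= \sum_(v in VX) (5 <= d v) * d v + \sum_(e in X) 0.
    by apply: sum_over_ends => e x y eX xy Ee; have := heavy eX xy Ee; lia.
  have S2 : \sum_(v in VX) (d v == 3) * d v <= \sum_(v in VX) 0 + \sum_(e in X) (e \in inner ends tight W).
    apply: (@sum_over_ends _ (fun=> 0)) => e x y eX xy Ee; have := heavy eX xy Ee.
    have := degD x; have := degD y; rewrite inE (tightE eX xy Ee).
    have [xX yX] : x \in VX /\ y \in VX.
      by rewrite !inE /deg; split; apply/card_gt0P; exists e; rewrite !inE eX Ee !inE eqxx ?orbT.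
    have -> : ends e \subset W = (x \in W) && (y \in W) by rewrite Ee subUset !sub1set.
    by rewrite ![_ \in W]in_set xX yX /=; lia.
  have S3 : \sum_(e in X) (e \in inner ends tight W) <= \sum_(v in VX) ((d v == 3) + (d v == D)).
    have -> : \sum_(e in X) (e \in inner ends tight W) = #|inner ends tight W|.
      rewrite -sum1_card -big_mkcondr; apply: eq_bigl => e; apply: andb_idl.
      by rewrite inE => /andP[/(subsetP tX)].
    apply: leq_trans (sparse W) _; rewrite -sum1_card.
    rewrite (eq_bigl (fun v => (v \in VX) && ((d v == 3) || (d v == D)))) => [|v]; last by rewrite in_set.
    by rewrite big_mkcondr; apply: leq_sum => v _; case: ifP => //; lia.
  have P : \sum_(v in VX) (60 + 8 * (d v)./2 + ((5 <= d v) * d v + 6 * ((d v == 3) + (d v == D)))) <=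
    \sum_(v in VX) (18 * d v + ((d v <= 4) * d v + 6 * ((d v == 3) * d v))).
    by apply: leq_sum => v /deg_ge3; lia.
  by move: S1 S2 S3 P; rewrite !big_split /= !big1_eq !sum_nat_const; clear; lia.
have D55 : D = 5 by lia.
have S : \sum_(v in VX) (3 * (d v == 3) + (d v == 4)) * d v <= 
    \sum_(v in VX) (d v == 5) * d v + \sum_(e in X) 2 * (e \in tight).
  apply: sum_over_ends => e x y eX xy Ee; have := heavy eX xy Ee.
  by have := degD x; have := degD y; rewrite (tightE eX xy Ee); lia.
have T : \sum_(e in X) 2 * (e \in tight) <= \sum_(v in VX) 2.
  rewrite -big_distrr sum_nat_const [X in _ <= X]mulnC leq_mul2l /=.
  have -> : \sum_(e in X) (e \in tight) = #|inner ends tight VX|.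
    rewrite -sum1_card -big_mkcondr; apply: eq_bigl => e; rewrite [RHS]inE.
    apply/andP/andP => [[eX eT]|[eT _]]; split=> //; last exact: (subsetP tX).
    apply/subsetP => v ve; rewrite inE card_gt0; apply/set0Pn; exists e.
    by rewrite inE eX.
  exact: sparse.
have P : \sum_(v in VX) (30 + 4 * (d v)./2 + ((d v == 5) * d v + 2)) <=
    \sum_(v in VX) (9 * d v + (3 * (d v == 3) + (d v == 4)) * d v).
  by apply: leq_sum => v /deg_ge3; have := degD v; lia.
by move: S T P; rewrite !big_split /= !big1_eq !sum_nat_const; clear; lia.
Qed.
End Counting.

Section Choosability.
Variables (V E : finType) (ends : E -> {set V}).
Hypothesis ends_inj : injective ends.
Hypothesis ends2 : forall e, #|ends e| = 2.
Hypothesis noC4 : forall x y u w e1 e2 e3 e4, uniq [:: x; y; u; w] ->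
  ends e1 = [set x; y] -> ends e2 = [set y; u] -> ends e3 = [set u; w] ->
  ends e4 = [set w; x] -> False.
Variables (disp : Order.disp_t) (K : orderType disp).
Variables (c : V -> E -> bool) (key : V -> E -> K).
Hypothesis key_inj : forall v e f, v \in ends e -> v \in ends f -> key v e = key v f -> e = f.
Hypothesis cert : forall e u v (z : {set E}), u \in ends e -> v \in ends e ->
  even_set ends z -> e \notin z -> parity z (before ends c key u e) = parity z (before ends c key v e).
Variables (A : zmodType) (g : E -> E -> A) (D : nat) (L : E -> seq A).
Hypothesis D5 : 5 <= D.
Hypothesis degD : forall v, deg ends [set: E] v <= D.
Hypothesis gN : forall e e', g e' e = (- g e e')%R.
Hypothesis L_uniq : forall e, uniq (L e).
Hypothesis L_size : forall e, size (L e) = D.+1.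

(** Induction on X: if all smaller sets are colourable and X is not, then the
    degree conditions derived from minimality contradict the Euler bound. *)
Theorem line_colorable (X : {set E}) : colorable (share_end ends) g L X.
Proof.
have [n] := ubnP #|X|; elim: n X => // n IH X lt; apply: boolp.contrapT => nX.
have mX (Y : {set E}) : Y \proper X -> colorable (share_end ends) g L Y.
  by move=> /proper_card YX; apply: IH; apply: leq_trans YX _.
have ls := @share_end_sym _ _ ends; have li := @share_end_irr _ _ ends.
have minX := min_degree_noncolorable ls li gN L_uniq L_size nX mX.
have degX v : deg ends X v <= D.
  apply: leq_trans (degD v); apply: subset_leq_card; apply/subsetP => e.
  by rewrite !inE => /andP[_ ->].
have heavy e x y : e \in X -> x != y -> ends e = [set x; y] -> D + 3 <= deg ends X x + deg ends X y.
  move=> eX xy Ee; have := minX e eX; have := deg_share_end ends_inj ends2 eX xy Ee.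
  by clear; lia.
have sparse (W : {set V}) : #|inner ends (tight ends X D) W| <= #|W|.
  apply: (card_inner ends_inj ends2) => a b f s us sT s0 bf ab ps la lb as_; apply: nX.
  apply: (@cycle_plus_edge_reducible _ _ _ g D.+1 L ls li gN L_uniq L_size X a b f s) => //.
  - by move=> e /sT; rewrite inE => /andP[].
  - by move=> e /sT; rewrite inE => /andP[].
have X0 : X != set0.
  apply/eqP => X0; apply: nX; exists (fun=> 0%R); split=> e; rewrite X0 inE //.
have kX v : {in star ends X v &, injective (key v)}.
  by move=> e f; rewrite !inE => /andP[_ ve] /andP[_ vf]; apply: key_inj.
have certX e u v z : e \in X -> u \in ends e -> v \in ends e ->
    z \in cycle_space ends X -> e \notin z ->
    parity z (before ends c key u e) = parity z (before ends c key v e).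
  by move=> _ ue ve /cycle_spaceP[_ ez]; apply: cert.
have deg3 := deg_ge3 ends2 degX heavy.
have := euler_bound ends_inj ends2 noC4 kX certX deg3 X0.
have ext (F : V -> nat) : (forall v, deg ends X v = 0 -> F v = 0) -> \sum_v F v = \sum_(v in covered ends X) F v.
  move=> F0; rewrite (bigID [in covered ends X]) /= [X in _ + X]big1 ?addn0 // => v.
  by rewrite inE -eqn0Ngt => /eqP/F0.
have := sum_deg ends2 X; rewrite !ext => [|v->|v ->] // S B.
apply: (euler_bound_fails ends_inj ends2 D5 degX heavy sparse).
move: S B; rewrite !big_split /= !big1_eq !sum_nat_const; clear; lia.
Qed.
End Choosability.

Local Open Scope ring_scope.

(** * Crossing parities of segments *)

Section Segments.
Variable R : realFieldType.
Implicit Types p q x y v : R * R.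

Definition point_at p q (t : R) : R * R := (p.1 + t * (q.1 - p.1), p.2 + t * (q.2 - p.2)).

Definition disjoint_segs p q x y := forall s t, 0 <= s <= 1 -> 0 <= t <= 1 -> point_at p q s <> point_at x y t.

Definition line_at p q a := p.2 + (q.2 - p.2) / (q.1 - p.1) * (a - p.1).

(** The vertical ray above x crosses the segment from p to q. Half-open
    abscissa intervals count a crossing at a common end of two segments once. *)
Definition below p q x := ((p.1 <= x.1) != (q.1 <= x.1)) && (x.2 < line_at p q x.1).

(** The point p lies above the segment from x to y, with the same convention on
    abscissae as for [below]. *)
Definition above p x y := ((p.1 <= x.1) != (p.1 <= y.1)) && (line_at x y p.1 < p.2).

Lemma line_at_sym p q a : p.1 != q.1 -> line_at p q a = line_at q p a.
Proof.
move=> pq; rewrite /line_at; field.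
by rewrite !subr_eq0 pq eq_sym pq.
Qed.

Lemma below_sym p q x : below p q x = below q p x.
Proof.
rewrite /below eq_sym; case: eqP => //= ne; rewrite line_at_sym //.
by apply: contra_not_neq ne => ->.
Qed.

Lemma above_sym p x y : above p x y = above p y x.
Proof.
rewrite /above eq_sym; case: eqP => //= ne; rewrite line_at_sym //.
by apply: contra_not_neq ne => ->.
Qed.

Lemma disjoint_segsC p q x y : disjoint_segs p q x y -> disjoint_segs x y p q.
Proof. by move=> H s t s1 t1 /esym; apply: H. Qed.

Lemma disjoint_segs_rev p q x y : disjoint_segs p q x y -> disjoint_segs q p x y.
Proof.
move=> H s t /andP[s0 s1] t1; have <- : point_at p q (1 - s) = point_at q p s by rewrite /point_at; congr (_, _); ring.
by apply: H => //; apply/andP; split; lra.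
Qed.

(** The signed height of the line pq over a point moving on the segment xy is an
    affine function. Where it vanishes, the segments meet. *)
Lemma no_sign_change p q x y t0 t1 : p.1 < q.1 -> 
  0 <= t0 <= 1 -> 0 <= t1 <= 1 -> 
  p.1 <= (point_at x y t0).1 <= q.1 -> p.1 <= (point_at x y t1).1 <= q.1 ->
  (point_at x y t0).2 < line_at p q (point_at x y t0).1 -> line_at p q (point_at x y t1).1 <= (point_at x y t1).2 ->
  disjoint_segs p q x y -> False.
Proof.
move=> pq t0b t1b; set u := point_at x y t0; set w := point_at x y t1 => ub wb f0 f1 dis.
pose f := line_at p q u.1 - u.2; pose g := w.2 - line_at p q w.1.
have fp : 0 < f by rewrite subr_gt0.
have gp : 0 <= g by rewrite subr_ge0.
pose la := f / (f + g).
have la01 : 0 <= la <= 1.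
  have fg : 0 < f + g by rewrite ltr_wpDr.
  by rewrite /la; apply/andP; split; [apply: divr_ge0; apply: ltW | rewrite ler_pdivrMr // mul1r lerDl].
have laE : la * (f + g) = f by rewrite divfK // gt_eqF // ltr_wpDr.
pose t := t0 + la * (t1 - t0).
pose a := u.1 + la * (w.1 - u.1).
have aE : (point_at x y t).1 = a by rewrite /a /t /u /w /=; ring.
have a01 : p.1 <= a <= q.1 by case/andP: la01 ub wb; rewrite /a; clear; move=> ? ? /andP[? ?] /andP[? ?]; apply/andP; split; nra.
apply: (dis ((a - p.1) / (q.1 - p.1)) t).
- rewrite divr_ge0 ?subr_ge0 ?(ltW pq) //=; last by case/andP: a01.
  by rewrite ler_pdivrMr ?subr_gt0 // mul1r lerD2r; case/andP: a01.
- by case/andP: la01 t0b t1b => ? ? /andP[? ?] /andP[? ?]; rewrite /t; apply/andP; split; nra.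
have ne : q.1 - p.1 != 0 by rewrite subr_eq0 gt_eqF.
rewrite [RHS]surjective_pairing aE /point_at; congr (_, _); first by field.
have -> : (point_at x y t).2 = u.2 + la * (w.2 - u.2) by rewrite /t /u /w /=; ring.
have -> : u.2 + la * (w.2 - u.2) = line_at p q u.1 + la * (line_at p q w.1 - line_at p q u.1).
  by move: laE; rewrite /f /g; lra.
by rewrite /line_at /a; field.
Qed.

Lemma same_side p q x y t0 t1 : disjoint_segs p q x y -> p.1 < q.1 ->
  0 <= t0 <= 1 -> 0 <= t1 <= 1 -> 
  p.1 <= (point_at x y t0).1 <= q.1 -> p.1 <= (point_at x y t1).1 <= q.1 ->
  ((point_at x y t0).2 < line_at p q (point_at x y t0).1) = ((point_at x y t1).2 < line_at p q (point_at x y t1).1).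
Proof.
move=> dis pq t0b t1b ub wb; apply/idP/idP => lt; rewrite ltNge; apply/negP => le.
  exact: no_sign_change pq t0b t1b ub wb lt le dis.
exact: no_sign_change pq t1b t0b wb ub lt le dis.
Qed.

Lemma point_at0 x y : point_at x y 0 = x.
Proof. by rewrite /point_at !mul0r !addr0; case: x. Qed.

Lemma point_at1 x y : point_at x y 1 = y.
Proof. by rewrite /point_at !mul1r !subrKC; case: y. Qed.

Definition abscissa x y a := (a - x.1) / (y.1 - x.1).

Lemma point_at_abscissa x y a : x.1 < y.1 -> point_at x y (abscissa x y a) = (a, line_at x y a).
Proof.
move=> xy; rewrite /point_at /line_at /abscissa; have ne : y.1 - x.1 != 0 by rewrite subr_eq0 gt_eqF.
by congr (_, _); field.
Qed.

Lemma abscissa01 x y a : x.1 < y.1 -> x.1 <= a <= y.1 -> 0 <= abscissa x y a <= 1.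
Proof.
move=> xy /andP[xa ay]; have d : 0 < y.1 - x.1 by rewrite subr_gt0.
apply/andP; split; first by apply: divr_ge0; rewrite ?(ltW d) // subr_ge0.
by rewrite ler_pdivrMr // mul1r lerD2r.
Qed.

Lemma line_at0 x y : line_at x y x.1 = x.2.
Proof. by rewrite /line_at subrr mulr0 addr0. Qed.

Lemma line_at1 x y : x.1 < y.1 -> line_at x y y.1 = y.2.
Proof. by move=> xy; rewrite /line_at divfK ?subrKC // subr_eq0 gt_eqF. Qed.

(** Over the common abscissae of two disjoint segments, one is above the other.
    The common interval has two ends, each of them an end of one of the segments,
    and each contributes the same answer; thus the four tests add up to 0. This
    is the invariance of crossing parities when x moves to y, up to a term which
    telescopes along closed polygons. *)
Lemma parity_disjoint p q x y : disjoint_segs p q x y ->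
  (below p q x (+) below p q y) (+) (above p x y (+) above q x y) = false.
Proof.
wlog pq : p q / p.1 <= q.1.
  move=> W dis; case: (leP p.1 q.1) => [/W|/ltW/W W']; first exact.
  rewrite below_sym [below p q y]below_sym [X in _ (+) X]addbC; apply: W'.
  exact: disjoint_segs_rev.
wlog xy : x y / x.1 <= y.1.
  move=> W dis; case: (leP x.1 y.1) => [/W|/ltW/W W']; first exact.
  rewrite above_sym [above q x y]above_sym [X in X (+) _]addbC; apply: W'.
  by apply: disjoint_segsC; apply: disjoint_segs_rev; apply: disjoint_segsC.
move=> dis; have dis' := disjoint_segsC dis.
have b0 : 0 <= (0 : R) <= 1 by rewrite lexx ler01.
have b1 : 0 <= (1 : R) <= 1 by rewrite lexx ler01.
have off u t : x.1 < y.1 -> x.1 <= u.1 <= y.1 -> u = point_at p q t -> 0 <= t <= 1 -> 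
    (line_at x y u.1 < u.2) = ~~ (u.2 < line_at x y u.1).
  move=> xy' ub uE tb; rewrite -leNgt le_eqVlt; case: eqP => //= eq.
  by case: (dis _ _ tb (abscissa01 xy' ub)); rewrite point_at_abscissa // eq -uE; case: (u).
rewrite /below /above; case: (leP q.1 x.1) => qx.
  by rewrite (le_trans pq qx) (le_trans (le_trans pq qx) xy) (le_trans qx xy).
case: (leP p.1 y.1) => py; last first.
  by rewrite [p.1 <= x.1]leNgt [q.1 <= y.1]leNgt (le_lt_trans xy py) (lt_le_trans py pq).
case: (leP p.1 x.1) => px; case: (leP q.1 y.1) => qy /=; rewrite ?addbF ?addFb.
- have xy' : x.1 < y.1 by lra.
  have pq' : p.1 < q.1 by lra.
  have qb : x.1 <= q.1 <= y.1 by rewrite ltW.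
  have := same_side dis pq' b0 (abscissa01 xy' qb); rewrite point_at0 point_at_abscissa //= line_at1 //.
  by rewrite px lexx ltW //= pq => -> //; rewrite addbb.
- have pq' : p.1 < q.1 by lra.
  have := same_side dis pq' b0 b1; rewrite point_at0 point_at1 px py !ltW // => -> //.
  by rewrite addbb.
- have xy' : x.1 < y.1 by lra.
  have := same_side dis' xy' b0 b1; rewrite point_at0 point_at1 qy py !ltW // => /(_ isT isT) S.
  have -> : (line_at x y p.1 < p.2) = ~~ (p.2 < line_at x y p.1).
    by apply: (off p 0 xy' _ _ b0); rewrite ?point_at0 // py ltW.
  have -> : (line_at x y q.1 < q.2) = ~~ (q.2 < line_at x y q.1).
    by apply: (off q 1 xy' _ _ b1); rewrite ?point_at1 // qy ltW.
  by rewrite S addbb.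
have xy' : x.1 < y.1 by lra.
have pq' : p.1 < q.1 by lra.
have pb : x.1 <= p.1 <= y.1 by rewrite py ltW.
have := same_side dis pq' b1 (abscissa01 xy' pb); rewrite point_at1 point_at_abscissa //= line_at0.
by rewrite py lexx pq ltW // => -> //; rewrite addbb.
Qed.

(** The slope b / a of a direction, scaled into the interval from -1 to 1 so that
    vertical directions are covered. *)
Definition slope (a b : R) := b / (a + `|b|).

Lemma slope_lt a b c d : 0 <= a -> 0 <= c -> 0 < a + `|b| -> 0 < c + `|d| ->
  0 < a \/ 0 < c -> (slope a b < slope c d) = (b * c < d * a).
Proof.
move=> a0 c0 ab cd ac; rewrite /slope ltr_pdivrMr // mulrAC ltr_pdivlMr //.
have [b0|b0] := leP 0 b; have [d0|d0] := leP 0 d.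
- by rewrite (ger0_norm b0) (ger0_norm d0); apply/idP/idP; lra.
- have d0' : 0 <= - d by rewrite oppr_ge0 ltW.
  rewrite (ger0_norm b0) (ltr0_norm d0).
  have := mulr_ge0 b0 c0; have := mulr_ge0 b0 d0'; have := mulr_ge0 d0' a0.
  by move=> *; apply/idP/idP; lra.
- rewrite (ger0_norm d0) in cd *; rewrite (ltr0_norm b0) in ab *.
  have b0' : 0 < - b by rewrite oppr_gt0.
  have h1 := mulr_ge0 d0 a0; have h2 := mulr_ge0 d0 (ltW b0'); have h3 := mulr_gt0 b0' cd.
  have h4 := mulr_ge0 (ltW b0') c0.
  have [c1|c1] := ltP 0 c; first by have h5 := mulr_gt0 b0' c1; apply/idP/idP; lra.
  have d1 : 0 < d by lra.
  have a1 : 0 < a by case: ac => //; lra.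
  by have h5 := mulr_gt0 d1 a1; apply/idP/idP; lra.
by rewrite (ltr0_norm b0) (ltr0_norm d0); apply/idP/idP; lra.
Qed.

Lemma slope_lt1 a b : 0 < a -> -1 < slope a b < 1.
Proof.
move=> a0; have := ler_norm b; have := ler_norm (- b); rewrite normrN => nbrs pb.
have ab : 0 < a + `|b| by rewrite ltr_pwDl.
by rewrite /slope ltr_pdivlMr // ltr_pdivrMr //; apply/andP; split; lra.
Qed.

(** Increases with the clockwise angle from the upward vertical to q: the right
    half-plane is mapped to the open interval from -1 to 1, the downward vertical
    to 1, the left half-plane to the interval from 1 to 3 and the upward vertical
    to 3. *)
Definition angle_key (q : R * R) := if 0 < q.1 then - slope q.1 q.2 else 2 + slope (- q.1) q.2.

(** The sum of the tests of [parity_disjoint] for two segments from a common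
    origin, with directions q and p: up to the telescoping term, the change of
    crossing parity with the first segment as a point moves along the second. *)
Definition turn (q p : R * R) := 
  (((0 <= p.1) != (q.1 <= p.1)) && (p.2 < q.2 / q.1 * p.1)) (+)
  (((q.1 <= 0) != (q.1 <= p.1)) && (p.2 / p.1 * q.1 < q.2)).

Lemma norm_gt0 (q : R * R) a : a = `|q.1| -> q != (0, 0) -> 0 < a + `|q.2|.
Proof.
move=> -> q0; rewrite lt_neqAle addr_ge0 // andbT eq_sym paddr_eq0 //.
by rewrite !normr_eq0; apply: contra q0 => /andP[/eqP q1 /eqP q2]; rewrite [q]surjective_pairing q1 q2.
Qed.

Lemma slope_le1 a b : 0 <= a -> 0 < a + `|b| -> -1 <= slope a b <= 1.
Proof.
move=> a0 ab; have := ler_norm b; have := ler_norm (- b); rewrite normrN => nbrs pb.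
by rewrite /slope ler_pdivlMr // ler_pdivrMr //; apply/andP; split; lra.
Qed.

Lemma slope0 b : b != 0 -> slope 0 b = if 0 < b then 1 else -1.
Proof.
move=> b0; rewrite /slope add0r; case: (ltrgtP 0 b) => [b1|b1|b1].
- by rewrite gtr0_norm ?divff.
- by rewrite ltr0_norm // invrN mulrN divff.
by rewrite -b1 eqxx in b0.
Qed.

(** From the vertical ray, directions to the right are reached clockwise and
    directions to the left counterclockwise; the edges passed on the way are the
    ones which precede, respectively follow, in the clockwise order. *)
Lemma turn_angle_key q p : q != (0, 0) -> p != (0, 0) ->
  turn q p = if angle_key p <= 1 then angle_key q < angle_key p else angle_key p < angle_key q.
Proof.
move=> q0 p0.
have key_left (u : R * R) : u != (0, 0) -> u.1 <= 0 -> -1 <= slope (- u.1) u.2 <= 1.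
  move=> u0 u1; apply: slope_le1; first by rewrite oppr_ge0.
  exact: norm_gt0 (esym (ler0_norm u1)) u0.
have p2 : p.1 = 0 -> p.2 != 0.
  by move=> p1; apply: contra p0 => /eqP p2; rewrite [p]surjective_pairing p1 p2.
have lt_left : p.1 <= 0 -> q.1 <= 0 -> p.1 < 0 \/ q.1 < 0 ->
    (2 + slope (- p.1) p.2 < 2 + slope (- q.1) q.2) = (q.2 * p.1 < p.2 * q.1).
  move=> p1 q1 pq; rewrite ltrD2l slope_lt ?oppr_ge0 ?oppr_gt0 //.
  - by rewrite !mulrN ltrN2.
  - exact: norm_gt0 (esym (ler0_norm p1)) p0.
  - exact: norm_gt0 (esym (ler0_norm q1)) q0.
rewrite /turn /angle_key; have [p1|p1|p1] := ltrgtP 0 p.1; have [q1|q1|q1] := ltrgtP 0 q.1.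
- have /andP[? ?] := slope_lt1 p.2 p1; rewrite ifT ?ltrN2; last by lra.
  have Np := norm_gt0 (esym (gtr0_norm p1)) p0; have Nq := norm_gt0 (esym (gtr0_norm q1)) q0.
  rewrite (slope_lt (ltW p1) (ltW q1) Np Nq); last by left.
  case: (leP q.1 p.1) => _ /=; first by rewrite mulrAC ltr_pdivrMr.
  by rewrite mulrAC ltr_pdivlMr // addbF.
- have /andP[? ?] := slope_lt1 p.2 p1; rewrite ifT; last by lra.
  have -> /= : q.1 <= p.1 by lra.
  by have /andP[? ?] := key_left q q0 (ltW q1); apply/esym/negbTE; rewrite -leNgt; lra.
- have /andP[? ?] := slope_lt1 p.2 p1; rewrite ifT; last by lra.
  have -> /= : q.1 <= p.1 by lra.
  have q1' : q.1 <= 0 by lra.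
  by have /andP[? ?] := key_left q q0 q1'; apply/esym/negbTE; rewrite -leNgt; lra.
- have /andP[? ?] := slope_lt1 q.2 q1.
  have np1 : 0 < - p.1 by lra.
  have /andP[? ?] := slope_lt1 p.2 np1; rewrite ifF; last by apply/negbTE; rewrite -ltNge; lra.
  have -> /= : (q.1 <= p.1) = false by apply/negbTE; rewrite -ltNge; lra.
  by apply/esym/negbTE; rewrite -leNgt; lra.
- have np1 : 0 < - p.1 by lra.
  have /andP[? ?] := slope_lt1 p.2 np1; rewrite ifF; last by apply/negbTE; rewrite -ltNge; lra.
  rewrite (lt_left (ltW p1) (ltW q1) (or_introl p1)).
  case: (leP q.1 p.1) => _ /=; first by rewrite mulrAC ltr_ndivlMr // addbF.
  by rewrite mulrAC ltr_ndivrMr.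
- have np1 : 0 < - p.1 by lra.
  have /andP[? ?] := slope_lt1 p.2 np1; rewrite ifF; last by apply/negbTE; rewrite -ltNge; lra.
  have q1' : q.1 <= 0 by lra.
  rewrite (lt_left (ltW p1) q1' (or_introl p1)) -q1.
  have -> /= : (0 <= p.1) = false by apply/negbTE; rewrite -ltNge; lra.
  by rewrite !mulr0 nmulr_llt0.
- have /andP[? ?] := slope_lt1 q.2 q1; have := p2 (esym p1) => p2'.
  rewrite -p1 oppr0 slope0 // mulr0.
  have -> /= : (q.1 <= 0) = false by apply/negbTE; rewrite -ltNge; lra.
  case: (ltrgtP 0 p.2) p2' => [pp _|pp _|] //.
    rewrite ifF; last by apply/negbTE; rewrite -ltNge; lra.
    by apply/esym/negbTE; rewrite -leNgt; lra.
  by rewrite addbF ifT; [apply/esym/idP; lra | lra].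
- have /andP[? ?] := key_left q q0 (ltW q1); have := p2 (esym p1) => p2'.
  rewrite -p1 (ltW q1) /= oppr0 slope0 //.
  case: (ltrgtP 0 p.2) p2' => [pp _|pp _|] //.
    rewrite ifF; last by apply/negbTE; rewrite -ltNge; lra.
    by apply/esym/negbTE; rewrite -leNgt; lra.
  by rewrite ifT; [apply/esym/negbTE; rewrite -leNgt; lra | lra].
have q1' : q.1 <= 0 by lra.
have /andP[? ?] := key_left q q0 q1'; have := p2 (esym p1) => p2'.
rewrite -p1 q1' /= oppr0 slope0 //.
case: (ltrgtP 0 p.2) p2' => [pp _|pp _|] //.
  rewrite ifF; last by apply/negbTE; rewrite -ltNge; lra.
  by apply/esym/negbTE; rewrite -leNgt; lra.
by rewrite ifT; [apply/esym/negbTE; rewrite -leNgt; lra | lra].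
Qed.

(** Equal keys mean equal rays; the conclusion exhibits a common point of the
    two segments other than the origin. *)
Lemma angle_key_inj q p : q != (0, 0) -> p != (0, 0) -> angle_key q = angle_key p ->
  exists s t, [/\ 0 < s <= 1, 0 < t <= 1, s * q.1 = t * p.1 & s * q.2 = t * p.2].
Proof.
move=> q0 p0 kqp; have Nq := norm_gt0 erefl q0; have Np := norm_gt0 erefl p0.
set m := `|p.1| + `|p.2| in Np; set n := `|q.1| + `|q.2| in Nq.
suff [E1 E2] : m * q.1 = n * p.1 /\ m * q.2 = n * p.2.
  have mn : 0 < m + n by rewrite addr_gt0.
  exists (m / (m + n)), (n / (m + n)); split.
  - by rewrite divr_gt0 //= ler_pdivrMr // mul1r lerDl ltW.
  - by rewrite divr_gt0 //= ler_pdivrMr // mul1r lerDr ltW.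
  - by rewrite mulrAC E1 mulrAC.
  - by rewrite mulrAC E2 mulrAC.
have slopes (a b c d : R) : 0 < `|a| + `|b| -> 0 < `|c| + `|d| -> slope `|a| b = slope `|c| d ->
    (`|c| + `|d|) * b = (`|a| + `|b|) * d /\ (`|c| + `|d|) * `|a| = (`|a| + `|b|) * `|c|.
  move=> nab ncd; have nab' := lt0r_neq0 nab; have ncd' := lt0r_neq0 ncd.
  rewrite /slope => /eqP; rewrite eqr_div // => /eqP E.
  have E' : (`|c| + `|d|) * `|b| = (`|a| + `|b|) * `|d|.
    by rewrite -[in LHS](gtr0_norm ncd) -[in RHS](gtr0_norm nab) -!normrM [_ * b]mulrC E mulrC.
  by split; [rewrite mulrC E mulrC | lra].
have key_left (u : R * R) : u != (0, 0) -> u.1 <= 0 -> -1 <= slope (- u.1) u.2 <= 1.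
  move=> u0 u1; apply: slope_le1; first by rewrite oppr_ge0.
  exact: norm_gt0 (esym (ler0_norm u1)) u0.
move: kqp; rewrite /angle_key; case: (ltP 0 q.1) => q1; case: (ltP 0 p.1) => p1.
- move=> /oppr_inj; rewrite -{1}(gtr0_norm q1) -{1}(gtr0_norm p1) => /(slopes _ _ _ _ Nq Np).
  rewrite -/m -/n => -[E2]; rewrite /m /n (gtr0_norm q1) (gtr0_norm p1) in E2 * => E1.
  by split.
- by have /andP[? ?] := slope_lt1 q.2 q1; have /andP[? ?] := key_left p p0 p1; lra.
- by have /andP[? ?] := slope_lt1 p.2 p1; have /andP[? ?] := key_left q q0 q1; lra.
move=> /addrI; rewrite -{1}(ler0_norm q1) -{1}(ler0_norm p1) => /(slopes _ _ _ _ Nq Np).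
rewrite -/m -/n => -[E2]; rewrite /m /n (ler0_norm q1) (ler0_norm p1) in E2 * => E1.
by split=> //; apply: oppr_inj; rewrite -!mulrN.
Qed.
End Segments.

(** * Polygonal drawings give rotation systems *)

Section Polygons.
Variables (R : realFieldType) (V E : finType) (ends : E -> {set V}).
Variables (pos : V -> R * R) (src tgt : E -> V) (a : E -> R * R) (l : E -> seq (R * R)).
Hypothesis endsE : forall e, ends e = [set src e; tgt e].
Hypothesis src_tgt : forall e, src e != tgt e.

(** The polygon of e runs from its source through a e and the points l e to its
    target; dir v e is its first point after v. *)
Definition dir v e := if v == src e then a e else last (a e) (l e).
Definition mids e := pairmap pair (a e) (l e).

Hypothesis mid_mid : forall e f s t, e != f -> s \in mids e -> t \in mids f ->
  disjoint_segs s.1 s.2 t.1 t.2.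
Hypothesis dir_mid : forall e f v t, e != f -> v \in ends e -> t \in mids f ->
  disjoint_segs (pos v) (dir v e) t.1 t.2.
Hypothesis dir_dir : forall e f v w, e != f -> v \in ends e -> w \in ends f -> v != w ->
  disjoint_segs (pos v) (dir v e) (pos w) (dir w f).
Hypothesis dir_star : forall e f v s t, e != f -> v \in ends e -> v \in ends f ->
  0 < s <= 1 -> 0 < t <= 1 -> point_at (pos v) (dir v e) s <> point_at (pos v) (dir v f) t.
Hypothesis dir_neq : forall e v, v \in ends e -> dir v e != pos v.

Definition along (F : R * R -> R * R -> bool) e : bool :=
  F (pos (src e)) (a e) (+) \big[addb/false]_(s <- mids e) F s.1 s.2 (+)
  F (pos (tgt e)) (last (a e) (l e)).

Lemma alongD F G e : along (fun p q => F p q (+) G p q) e = along F e (+) along G e.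
Proof. by rewrite /along big_split /=; do 2 case: (F _ _); case: (\big[_/_]_(_ <- _) _); do 2 case: (G _ _); case: (\big[_/_]_(_ <- _) _). Qed.

Lemma along_telescope (h : R * R -> bool) e :
  along (fun p q => h p (+) h q) e = h (pos (src e)) (+) h (pos (tgt e)).
Proof.
rewrite /along /mids; have -> : \big[addb/false]_(s <- pairmap pair (a e) (l e)) (h s.1 (+) h s.2)
    = h (a e) (+) h (last (a e) (l e)).
  elim: (l e) (a e) => [|q s IH] p /=; first by rewrite big_nil addbb.
  by rewrite big_cons IH /=; case: (h p); case: (h q); case: (h (last q s)).
by case: (h (a e)); case: (h (last (a e) (l e))); case: (h (pos (src e)));
  case: (h (pos (tgt e))).
Qed.

(** Each vertex is an end of an even number of edges of z. *)
Lemma even_telescope (h : R * R -> bool) z : even_set ends z ->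
  parity z (along (fun p q => h p (+) h q)) = false.
Proof.
move=> ez; rewrite (eq_parity (g := fun e => \big[addb/false]_(v in ends e) h (pos v))); last first.
  move=> e _; rewrite along_telescope endsE big_setU1 ?inE ?src_tgt //=.
  by rewrite big_set1.
rewrite /parity (exchange_big_dep predT) //= big1 // => v _.
transitivity (h (pos v) && parity z (inc ends v)); last by rewrite (ez v) andbF.
rewrite /parity; case: (h (pos v)); last by rewrite big1.
by rewrite [LHS]big_mkcond [RHS]big_mkcond; apply: eq_bigr => e _; rewrite /inc; case: (e \in z); case: (v \in _).
Qed.

Definition winding z x := parity z (along (fun p q => below p q x)).

(** The terms for the segment ends telescope along each polygon, and cancel at
    the vertices since z is even. *)
Lemma winding_step z x y (r : E -> bool) : even_set ends z ->
  {in z, forall e, along (fun p q => (below p q x (+) below p q y) (+) (above p x y (+) above q x y)) e = r e} ->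
  winding z x (+) winding z y = parity z r.
Proof.
move=> ez H; rewrite -(eq_parity H) (eq_parity (g := fun e => 
   (along (fun p q => below p q x) e (+) along (fun p q => below p q y) e) (+)
   along (fun p q => above p x y (+) above q x y) e)); last by move=> e _; rewrite !alongD.
have T : parity z (fun e => along (fun p q => above p x y (+) above q x y) e) = false.
  exact: (even_telescope (fun p => above p x y) ez).
by rewrite parityD T addbF parityD.
Qed.

Lemma src_end e : src e \in ends e. Proof. by rewrite endsE !inE eqxx. Qed.
Lemma tgt_end e : tgt e \in ends e. Proof. by rewrite endsE !inE eqxx orbT. Qed.
Lemma dir_src e : dir (src e) e = a e. Proof. by rewrite /dir eqxx. Qed.
Lemma dir_tgt e : dir (tgt e) e = last (a e) (l e).
Proof. by rewrite /dir eq_sym (negPf (src_tgt e)). Qed.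

Lemma mid_step z e s : even_set ends z -> e \notin z -> s \in mids e ->
  winding z s.1 = winding z s.2.
Proof.
move=> ez eN se; apply/eqP/negPn/negP => ne.
have : winding z s.1 (+) winding z s.2 by move: ne; case: (winding z _); case: (winding z _).
rewrite (@winding_step _ _ _ (fun=> false) ez) => [|f fz]; first by rewrite /parity big1.
have ef : e != f by apply: contraNneq eN => ->.
have fe : f != e by rewrite eq_sym.
rewrite /along big_seq big1 => [|t tf]; last by apply: parity_disjoint; apply: mid_mid fe tf se.
rewrite -dir_tgt -dir_src.
by rewrite !parity_disjoint //; apply: dir_mid fe _ se; rewrite ?src_end ?tgt_end.
Qed.

Definition vec v e : R * R := ((dir v e).1 - (pos v).1, (dir v e).2 - (pos v).2).

Lemma vec_neq0 e v : v \in ends e -> vec v e != (0, 0).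
Proof.
move=> /dir_neq; apply: contra => /eqP[/eqP H1 /eqP H2].
by move: H1 H2; rewrite !subr_eq0 [dir v e]surjective_pairing [pos v]surjective_pairing /= => /eqP-> /eqP->.
Qed.

Lemma turnE (v q p : R * R) : 
  (below v q v (+) below v q p) (+) (above v v p (+) above q v p) =
  turn (q.1 - v.1, q.2 - v.2) (p.1 - v.1, p.2 - v.2).
Proof.
have -> : below v q v = false by rewrite /below line_at0 ltxx andbF.
have -> : above v v p = false by rewrite /above line_at0 ltxx andbF.
by rewrite /turn /below /above /line_at /= subr_ge0 subr_le0 lerD2r ltrBlDl ltrBrDl.
Qed.

Definition angle v e : R := angle_key (vec v e).

(** Only the first segments at v of the edges in z share a point with the first
    segment of e, and each contributes [turn]. If e leaves v to the left,
    this counts the edges after e instead of those before, which is the same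
    modulo 2 because z has even degree at v. *)
Lemma dir_step z e v : even_set ends z -> e \notin z -> v \in ends e ->
  winding z (pos v) (+) winding z (dir v e) =
  parity z (fun f => inc ends v f && (angle v f < angle v e)).
Proof.
move=> ez eN ve.
have turnP f : f \in z -> v \in ends f -> turn (vec v f) (vec v e) =
    if angle v e <= 1 then angle v f < angle v e else angle v e < angle v f.
  by move=> fz vf; apply: turn_angle_key; apply: vec_neq0.
rewrite (@winding_step _ _ _ (fun f => inc ends v f && turn (vec v f) (vec v e)) ez) => [|f fz].
  case: (leP (angle v e) 1) => le1.
    apply: eq_parity => f fz; case: (boolP (inc ends v f)) => //= vf.
    by rewrite turnP // le1.
  rewrite -[RHS]addbF -(ez v) -parityD; apply: eq_parity => f fz.
  case: (boolP (inc ends v f)) => //= vf; rewrite addbT turnP // leNgt le1 /=.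
  rewrite -leNgt le_eqVlt; case: eqP => //= kE.
  have ef : e != f by apply: contraNneq eN => ->.
  have [s [t [s1 t1 H1 H2]]] := angle_key_inj (vec_neq0 vf) (vec_neq0 ve) (esym kE).
  by case: (dir_star ef ve vf t1 s1); rewrite /point_at -H1 -H2.
have ef : e != f by apply: contraNneq eN => ->.
have fe : f != e by rewrite eq_sym.
rewrite /along [X in _ (+) X (+) _]big_seq [X in _ (+) X (+) _]big1 => [|t tf]; last first.
  by apply: parity_disjoint; apply: disjoint_segsC; apply: dir_mid ef ve tf.
have far w : w \in ends f -> w != v ->
   (below (pos w) (dir w f) (pos v) (+) below (pos w) (dir w f) (dir v e))
   (+) (above (pos w) (pos v) (dir v e) (+) above (dir w f) (pos v) (dir v e)) = false.
  by move=> wf wv; apply: parity_disjoint; apply: dir_dir fe wf ve wv.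
rewrite addbF -dir_tgt -dir_src /inc endsE !inE.
case: (eqVneq v (src f)) => [vs|vs] /=.
  by rewrite -vs turnE far ?addbF ?tgt_end // vs eq_sym src_tgt.
rewrite far ?src_end 1?eq_sym //=; case: (eqVneq v (tgt f)) => [vt|vt] /=.
  by rewrite -vt turnE.
by rewrite far ?tgt_end 1?eq_sym.
Qed.

Definition crossings v e := along (fun p q => below p q (pos v)) e.

(** The crossing parity is constant along the inner points of the polygon of e,
    as z avoids e; compare its values next to the two ends. *)
Lemma polygon_certificate e u v z : u \in ends e -> v \in ends e ->
  even_set ends z -> e \notin z ->
  parity z (before ends crossings angle u e) = parity z (before ends crossings angle v e).
Proof.
move=> ue ve ez eN.
have at_end w : w \in ends e -> parity z (before ends crossings angle w e) = winding z (dir w e).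
  by move=> we; rewrite /before parityD -(dir_step ez eN we) /winding addKb.
rewrite !at_end //.
have chain : winding z (a e) = winding z (last (a e) (l e)).
  have := @mid_step z e _ ez eN; rewrite /mids; elim: (l e) (a e) => //= q s IH p H.
  rewrite -IH; first by apply: (H (p, q)); rewrite mem_head.
  by move=> t ts; apply: H; rewrite inE ts orbT.
have all w : w \in ends e -> winding z (dir w e) = winding z (a e).
  by rewrite endsE !inE => /orP[]/eqP->; rewrite ?dir_src ?dir_tgt.
by rewrite !all.
Qed.

Lemma angle_inj v e f : v \in ends e -> v \in ends f -> angle v e = angle v f -> e = f.
Proof.
move=> ve vf kE; apply/eqP/negPn/negP => ef.
have [s [t [s1 t1 H1 H2]]] := angle_key_inj (vec_neq0 vf) (vec_neq0 ve) (esym kE).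
by case: (dir_star ef ve vf t1 s1); rewrite /point_at -H1 -H2.
Qed.
End Polygons.

(** * From arcs to polygons *)

Section Distance.
Variable R : realFieldType.
Implicit Types p q x y : R * R.

(** Balls are squares for this distance, as in the product topology. *)
Definition dst p q : R := Num.max `|p.1 - q.1| `|p.2 - q.2|.

Lemma dst_lt p q e : (dst p q < e) = (`|p.1 - q.1| < e) && (`|p.2 - q.2| < e).
Proof. by rewrite /dst gt_max. Qed.

Lemma dst_ge0 p q : 0 <= dst p q.
Proof. by rewrite /dst le_max normr_ge0. Qed.

Lemma dstC p q : dst p q = dst q p.
Proof. by rewrite /dst distrC [X in Num.max _ X]distrC. Qed.

Lemma dst_triangle p q x : dst p x <= dst p q + dst q x.
Proof.
rewrite /dst ge_max; apply/andP; split.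
  by apply: (le_trans (ler_distD q.1 _ _)); apply: lerD; rewrite le_max lexx.
by apply: (le_trans (ler_distD q.2 _ _)); apply: lerD; rewrite le_max lexx orbT.
Qed.

Lemma dst_gt0 p q : p <> q -> 0 < dst p q.
Proof.
move=> pq; rewrite lt_neqAle dst_ge0 andbT eq_sym; apply/negP => /eqP d0; apply: pq.
have : dst p q <= 0 by rewrite d0.
rewrite /dst ge_max !normr_le0 !subr_eq0 => /andP[/eqP H1 /eqP H2].
by rewrite [p]surjective_pairing [q]surjective_pairing H1 H2.
Qed.

Lemma dst_point_at p q s : 0 <= s -> dst p (point_at p q s) = s * dst p q.
Proof.
move=> s0; rewrite /dst /point_at /= !opprD !addrA !subrr !add0r !normrN !normrM (ger0_norm s0).
by rewrite -maxr_pMr // distrC [X in Num.max _ X]distrC.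
Qed.

Lemma dst_point_at_end p q s : s <= 1 -> dst (point_at p q s) q = (1 - s) * dst p q.
Proof.
move=> s1; have -> : point_at p q s = point_at q p (1 - s) by rewrite /point_at; congr (_, _); ring.
by rewrite dstC dst_point_at ?subr_ge0 // dstC.
Qed.
End Distance.


Section Trimming.
Variables (T : eqType) (e : rel T).

Lemma last_exit (P : pred T) x s : path e x s -> has P (x :: s) -> ~~ P (last x s) ->
  exists y z s2, [/\ P y && e y z, path e z s2, last z s2 = last x s,
    all (predC P) (z :: s2) & {subset z :: s2 <= s}].
Proof.
elim: s x => [|z s IH] x /=; first by rewrite orbF => _ ->.
move=> /andP[xz zs] hx lastN; case: (boolP (has P (z :: s))) => [hz|].
  have [y [z' [s2 [yz' ps2 ls2 as2 ss2]]]] := IH z zs hz lastN.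
  by exists y, z', s2; split=> // u /ss2; rewrite inE orbC => ->.
rewrite -all_predC => az; exists x, z, s; split=> //.
by move: az hx; rewrite -[P z || _]/(has P (z :: s)) all_predC => /negPf->; rewrite orbF => ->.
Qed.

Lemma first_entry (P : pred T) x s : path e x s -> ~~ P x -> P (last x s) ->
  exists s1 y, [/\ path e x s1, e (last x s1) y, P y, all (predC P) (x :: s1) & {subset x :: s1 <= x :: s}].
Proof.
elim: s x => [|z s IH] x /=; first by move=> _ /negPf->.
move=> /andP[xz zs] Nx lastP; case: (boolP (P z)) => [Pz|Nz].
  exists [::], z; split=> //=; first by rewrite Nx.
  by move=> u; rewrite inE => /eqP->; rewrite mem_head.
have [s1 [y [p1 ly Py a1 ss1]]] := IH z zs Nz lastP.
exists (z :: s1), y; split=> //=; first by rewrite xz.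
  by move: a1 => /= ->; rewrite Nx.
by move=> u; rewrite inE => /orP[/eqP->|/ss1]; rewrite ?mem_head // => us; rewrite inE us orbT.
Qed.

Lemma mem_pairmap x s t : path e x s -> t \in pairmap pair x s ->
  [/\ t.1 \in x :: s, t.2 \in x :: s & e t.1 t.2].
Proof.
elim: s x => //= z s IH x /andP[xz zs]; rewrite inE => /orP[/eqP->|/(IH z zs)[H1 H2 H3]] /=.
  by rewrite !inE !eqxx ?orbT.
by rewrite H1 orbT in_cons H2 orbT.
Qed.
End Trimming.

Lemma finite_uniform (R : realFieldType) (I : finType) (Q : I -> R -> Prop) :
  (forall i, exists2 eta, 0 < eta & Q i eta) ->
  (forall i eta eta', Q i eta -> 0 < eta' <= eta -> Q i eta') ->
  exists2 eta, 0 < eta & forall i, Q i eta.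
Proof.
move=> ex mono; suff [eta e0 H] : exists2 eta, 0 < eta & {in enum I, forall i, Q i eta}.
  by exists eta => // i; apply: H; rewrite mem_enum.
elim: (enum I) => [|i s [eta e0 H]]; first by exists 1.
have [d d0 Qd] := ex i; exists (Num.min d eta); first by rewrite lt_min d0.
move=> j; rewrite inE => /orP[/eqP->|/H Qj].
  by apply: mono Qd _; rewrite lt_min d0 e0 ge_min lexx.
by apply: mono Qj _; rewrite lt_min d0 e0 ge_min lexx orbT.
Qed.


From mathcomp Require Import all_classical all_reals all_analysis.
From mathcomp Require Import finmap finset.
Import numFieldNormedType.Exports.

Section Compactness.
Variable R : realType.

(** Compactness of the unit interval, in the form used below: a property that
    holds for small eta near each point holds for one eta everywhere. *)
Lemma compact_uniform (P : R -> R -> Prop) :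
  (forall t, 0 <= t <= 1 -> exists2 d, 0 < d & 
     forall t', 0 <= t' <= 1 -> `|t - t'| < d -> forall eta, 0 < eta < d -> P eta t') ->
  exists2 eta, 0 < eta & forall t, 0 <= t <= 1 -> P eta t.
Proof.
move=> H; have := @segment_compact R 0 1.
rewrite compact_near_coveringP -near_covering_withinP => /(_ R (at_right (0 : R)) P _).
case=> [t /=|d /= d0 dP].
  rewrite in_itv /= => t01; have [d d0 dP] := H t t01.
  exists (ball t d, [set eta | 0 < eta < d]%classic) => /=.
    split; first exact: nbhsx_ballx.
    by exists d => //= eta; rewrite /= sub0r normrN => + e0; rewrite gtr0_norm // e0.
  case=> t' eta /= [tt' eta_d]; rewrite in_itv /= => t'01.
  exact: dP.
exists (d / 2); first by rewrite divr_gt0.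
move=> t t01; apply: (dP (d / 2)) => /=; last by rewrite in_itv.
  by rewrite sub0r normrN gtr0_norm ?divr_gt0 // ltr_pdivrMr // ltr_pMr // ltr1n.
by rewrite divr_gt0.
Qed.

Definition cont01 (f : R -> R * R) := forall t eps, 0 <= t <= 1 -> 0 < eps ->
  exists2 d, 0 < d & forall t', 0 <= t' <= 1 -> `|t - t'| < d -> dst (f t) (f t') < eps.

Lemma within_cont01 (f : R -> R * R) : {within `[0, 1], continuous f}%classic -> cont01 f.
Proof.
move=> /subspace_continuousP cf t eps t01 e0.
have := cf t; rewrite /= in_itv /= => /(_ t01) /cvg_ballP /(_ eps e0).
rewrite /within /= => -[d /= d0 dP]; exists d => // t' t'01 tt'.
have := dP t' tt'; rewrite in_itv /= => /(_ t'01) [/= b1 b2].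
by rewrite dst_lt; apply/andP.
Qed.

Lemma uniform_cont (f : R -> R * R) eps : cont01 f -> 0 < eps ->
  exists2 d, 0 < d & forall t s, 0 <= t <= 1 -> 0 <= s <= 1 -> `|t - s| < d -> dst (f t) (f s) < eps.
Proof.
move=> cf e0.
have [t t01|d d0 dP] := @compact_uniform (fun d t => forall s, 0 <= s <= 1 -> `|t - s| < d -> dst (f t) (f s) < eps).
  have [|d d0 dP] := cf t (eps / 2) t01; first by rewrite divr_gt0.
  exists (d / 2); first by rewrite divr_gt0.
  move=> t' t'01 tt' eta /andP[eta0 etad] s s01 t's.
  have h1 := dP t' t'01; have h2 := dP s s01.
  have ts := ler_distD t' t s.
  have := dst_triangle (f t') (f t) (f s); rewrite [dst (f t') (f t)]dstC.
  have : dst (f t) (f t') < eps / 2 by apply: h1; lra.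
  have : dst (f t) (f s) < eps / 2 by apply: h2; lra.
  lra.
by exists d => // t s t01 s01; apply: dP.
Qed.

Lemma dist_point (f : R -> R * R) p : cont01 f -> (forall t, 0 <= t <= 1 -> f t <> p) ->
  exists2 eta, 0 < eta & forall t, 0 <= t <= 1 -> eta <= dst p (f t).
Proof.
move=> cf fp; apply: compact_uniform => t t01.
have m0 := dst_gt0 (fp t t01); have [|d d0 dP] := cf t (dst (f t) p / 2) t01; first by rewrite divr_gt0.
exists (Num.min d (dst (f t) p / 2)); first by rewrite lt_min d0 divr_gt0.
move=> t' t'01; rewrite lt_min => /andP[tt' _] eta /andP[_]; rewrite lt_min => /andP[_ le].
have := dst_triangle (f t) (f t') p; have := dP t' t'01 tt'; rewrite [dst p _]dstC; lra.
Qed.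

(** The points of f outside the open ball of radius rho around v form a compact
    set disjoint from g. *)
Lemma dist_arcs (f g : R -> R * R) v rho : cont01 f -> cont01 g ->
  (forall t s, 0 <= t <= 1 -> 0 <= s <= 1 -> rho <= dst v (f t) -> f t <> g s) ->
  exists2 eta, 0 < eta & forall t s, 0 <= t <= 1 -> 0 <= s <= 1 ->
    rho < dst v (f t) -> eta <= dst (f t) (g s).
Proof.
move=> cf cg fg.
have [t t01|eta e0 eP] := @compact_uniform (fun eta t => rho < dst v (f t) -> 
   forall s, 0 <= s <= 1 -> eta <= dst (f t) (g s)).
  case: (leP rho (dst v (f t))) => [ge|lt].
    have [s s01|m m0 mP] := @dist_point g (f t) cg; first by move=> /esym; apply: fg.
    have [|d d0 dP] := cf t (m / 2) t01; first by rewrite divr_gt0.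
    exists (Num.min d (m / 2)); first by rewrite lt_min d0 divr_gt0.
    move=> t' t'01; rewrite lt_min => /andP[tt' _] eta /andP[_]; rewrite lt_min => /andP[_ le] _ s s01.
    have := mP s s01; have := dP t' t'01 tt'; have := dst_triangle (f t) (f t') (g s); lra.
  have [|d d0 dP] := cf t (rho - dst v (f t)) t01; first by rewrite subr_gt0.
  exists d => // t' t'01 tt' eta _ gt.
  by have := dP t' t'01 tt'; have := dst_triangle v (f t) (f t'); lra.
by exists eta => // t s t01 s01 gt; apply: eP.
Qed.
End Compactness.

Section Drawing.
Variables (R : realType) (V E : finType) (ends : E -> {set V}).
Hypothesis ends_inj : injective ends.
Hypothesis ends2 : forall e, #|ends e| = 2.
Variables (pos : V -> R * R) (arc : E -> R -> R * R) (src tgt : E -> V).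
Hypothesis endsE : forall e, ends e = [set src e; tgt e].
Hypothesis pos_inj : injective pos.
Hypothesis arc_cont : forall e, cont01 (arc e).
Hypothesis arc0 : forall e, arc e 0 = pos (src e).
Hypothesis arc1 : forall e, arc e 1 = pos (tgt e).
Hypothesis arc_pos : forall e t v, 0 < t < 1 -> arc e t <> pos v.
Hypothesis arc_arc : forall e f t s, 0 < t < 1 -> 0 < s < 1 -> arc e t = arc f s -> e = f.

Lemma src_tgt e : src e != tgt e.
Proof. by have := ends2 e; rewrite endsE cards2; case: (_ == _). Qed.

Lemma unit_cases (t : R) : 0 <= t <= 1 -> [\/ t = 0, t = 1 | 0 < t < 1].
Proof.
case/andP; rewrite le_eqVlt => /orP[/eqP<- _|t0]; first exact: Or31.
by rewrite le_eqVlt => /orP[/eqP->|t1]; [exact: Or32 | apply: Or33; rewrite t0].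
Qed.

Lemma arc_vertex e t v : 0 <= t <= 1 -> arc e t = pos v -> v \in ends e.
Proof.
move=> /unit_cases[->|->|t01]; rewrite endsE !inE.
- by rewrite arc0 => /pos_inj->; rewrite eqxx.
- by rewrite arc1 => /pos_inj->; rewrite eqxx orbT.
by move=> /(arc_pos t01).
Qed.

Lemma arc_end e t : t = 0 \/ t = 1 -> exists v, arc e t = pos v.
Proof. by case=> ->; [exists (src e) | exists (tgt e)]. Qed.

Lemma arcs_meet e f t s : e != f -> 0 <= t <= 1 -> 0 <= s <= 1 -> arc e t = arc f s ->
  exists2 v, v \in ends e :&: ends f & arc e t = pos v.
Proof.
move=> ef t01 s01 eq.
have common v : arc e t = pos v -> exists2 v, v \in ends e :&: ends f & arc e t = pos v.
  move=> ev; exists v => //; rewrite inE (arc_vertex t01 ev) /=.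
  by apply: (arc_vertex s01); rewrite -eq.
have [t0|t1|t01'] := unit_cases t01.
- by have [v /common] := arc_end e (or_introl t0).
- by have [v /common] := arc_end e (or_intror t1).
have [s0|s1|s01'] := unit_cases s01.
- by have [v] := arc_end f (or_introl s0); rewrite -eq => /common.
- by have [v] := arc_end f (or_intror s1); rewrite -eq => /common.
by move: ef; rewrite (arc_arc t01' s01' eq) eqxx.
Qed.

(** A scale r at which the boxes around vertices are disjoint and are entered
    only by the arcs of incident edges. *)
Lemma vertex_gap : exists2 r, 0 < r & (forall v w, v != w -> 4 * r <= dst (pos v) (pos w)) /\
  forall e v t, v \notin ends e -> 0 <= t <= 1 -> 3 * r <= dst (pos v) (arc e t).
Proof.
have [|i e e' H|r1 r10 H1] := @finite_uniform R (V * V)%type (fun i r => i.1 != i.2 -> 4 * r <= dst (pos i.1) (pos i.2)).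
- move=> [v w] /=; case: (eqVneq v w) => [->|vw]; first by exists 1.
  exists (dst (pos v) (pos w) / 4) => [|_].
    by apply: divr_gt0 => //; apply: dst_gt0 => /pos_inj/eqP; rewrite (negPf vw).
  lra.
- by move=> /andP[_ le] /H; lra.
have [|i e e' H|r2 r20 H2] := @finite_uniform R (E * V)%type (fun i r => i.2 \notin ends i.1 -> 
    forall t, 0 <= t <= 1 -> 3 * r <= dst (pos i.2) (arc i.1 t)).
- move=> [e v] /=; case: (boolP (v \in ends e)) => [ve|vN]; first by exists 1.
  have [t t01 /(arc_vertex t01)|eta e0 eP] := @dist_point R (arc e) (pos v) (@arc_cont e).
    by rewrite (negPf vN).
  by exists (eta / 3) => [|_ t /eP]; [apply: divr_gt0 | lra].
- by move=> /andP[_ le] /H K t /K; lra.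
exists (Num.min r1 r2); first by rewrite lt_min r10.
split=> [v w vw|e v t vN t01].
  by have := H1 (v, w) vw => /=; apply: le_trans; rewrite ler_pM2l // ge_min lexx.
by have := H2 (e, v) vN t t01 => /=; apply: le_trans; rewrite ler_pM2l // ge_min lexx orbT.
Qed.

(** Distinct arcs meet only at common ends, and by compactness they keep a
    positive distance outside the boxes around these. *)
Lemma arc_gap r : 0 < r -> exists2 eta, 0 < eta & forall e f t s, e != f ->
  0 <= t <= 1 -> 0 <= s <= 1 ->
  (forall v, v \in ends e :&: ends f -> r < dst (pos v) (arc e t)) ->
  eta <= dst (arc e t) (arc f s).
Proof.
move=> r0.
have [|i a b H|eta e0 H] := @finite_uniform R (E * E)%type (fun i eta => forall t s, i.1 != i.2 ->
  0 <= t <= 1 -> 0 <= s <= 1 ->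
  (forall v, v \in ends i.1 :&: ends i.2 -> r < dst (pos v) (arc i.1 t)) ->
  eta <= dst (arc i.1 t) (arc i.2 s)).
- move=> [e f] /=; case: (eqVneq e f) => [->|ef]; first by exists 1.
  case: (set_0Vmem (ends e :&: ends f)) => [no|[v vef]].
    (* Without a common end, the negative radius makes all points count as far. *)
    have [t s t01 s01 _|eta e0 eP] := @dist_arcs R (arc e) (arc f) (0, 0) (-1) (@arc_cont e) (@arc_cont f).
      by move=> /(arcs_meet ef t01 s01)[v]; rewrite no inE.
    exists eta => // t s _ t01 s01 _; apply: eP => //.
    by apply: lt_le_trans (dst_ge0 _ _); rewrite ltrN10.
  have [t s t01 s01 ge|eta e0 eP] := @dist_arcs R (arc e) (arc f) (pos v) r (@arc_cont e) (@arc_cont f).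
    move=> /(arcs_meet ef t01 s01)[w wef ew]; move: ge; rewrite ew.
    suff -> : v = w by rewrite /dst !subrr normr0 maxxx leNgt r0.
    move: vef wef; rewrite !inE => /andP[ve vf] /andP[we wf]; apply/eqP/negPn/negP => vw.
    by move: ef; rewrite (ends_inj (etrans (ends_pair ends2 vw ve we) (esym (ends_pair ends2 vw vf wf)))) eqxx.
  by exists eta => // t s _ t01 s01 far; apply: eP => //; apply: far.
- by move=> b0 t s ef t01 s01 far; apply: le_trans (H t s ef t01 s01 far); case/andP: b0.
by exists eta => // e f t s ef t01 s01 far; apply: (H (e, f)).
Qed.
(** Points of the arc at the parameters i / N, for N given by uniform
    continuity. *)
Lemma samples e eps : 0 < eps -> exists L : seq (R * R),
  [/\ path (fun p q => dst p q < eps) (pos (src e)) L, last (pos (src e)) L = pos (tgt e) &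
   forall p, p \in pos (src e) :: L -> exists2 t, 0 <= t <= 1 & p = arc e t].
Proof.
move=> eps0; have [d d0 dP] := uniform_cont (@arc_cont e) eps0.
pose N := (Num.truncn d^-1).+1; have N0 : 0 < N%:R :> R by rewrite ltr0n.
have Nd : N%:R^-1 < d by rewrite -[d]invrK ltf_pV2 ?posrE ?invr_gt0 // truncnS_gt.
pose f i := arc e (i%:R / N%:R).
have f01 i : (i <= N)%N -> 0 <= (i%:R / N%:R : R) <= 1.
  by move=> iN; rewrite divr_ge0 ?ler0n //= ler_pdivrMr // mul1r ler_nat.
have step i : (i < N)%N -> dst (f i) (f i.+1) < eps.
  move=> iN; apply: dP; [exact/f01/ltnW | exact: f01 |].
  rewrite distrC -mulrBl -natrB // subSnn mul1r ger0_norm // invr_ge0 ltW //.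
have f0 : f 0%N = pos (src e) by rewrite /f mul0r arc0.
have fN : f N = pos (tgt e) by rewrite /f divff ?gt_eqF // arc1.
have path_f k n : (k + n <= N)%N -> path (fun p q => dst p q < eps) (f k) [seq f i | i <- iota k.+1 n] /\
    last (f k) [seq f i | i <- iota k.+1 n] = f (k + n)%N.
  elim: n k => [|n IH] k kn /=; first by rewrite addn0.
  rewrite step ?(leq_trans _ kn) ?addnS ?ltnS ?leq_addr //=.
  by have := IH k.+1; rewrite addSnnS addnS in kn *; apply.
have [p1 p2] := path_f 0%N N (leqnn _).
exists [seq f i | i <- iota 1 N]; rewrite -f0 -fN; split=> // p.
rewrite inE => /orP[/eqP->|/mapP[i]]; first by exists (0 / N%:R); [exact: (f01 0%N) | ].
by rewrite mem_iota add1n ltnS => /andP[_ iN] ->; exists (i%:R / N%:R); [exact: f01 | ].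
Qed.

Definition close (eps : R) (p q : R * R) := dst p q < eps.

(** Keep the samples between the last one in the box around the source and the
    first later one in the box around the target. *)
Lemma trimmed_polygon e r eps : 0 < eps -> eps <= r -> 4 * r <= dst (pos (src e)) (pos (tgt e)) ->
  exists a l, [/\ path (close eps) a l,
    forall p, p \in a :: l -> exists2 t, 0 <= t <= 1 & p = arc e t,
    forall p v, p \in a :: l -> v \in ends e -> r < dst (pos v) p,
    dst (pos (src e)) a < r + eps & dst (pos (tgt e)) (last a l) < r + eps].
Proof.
move=> eps0 eps_r gap; have [L [pL lL sL]] := samples e eps0.
pose P := [pred p | dst (pos (src e)) p <= r]; pose Q := [pred p | dst (pos (tgt e)) p <= r].
have self v : dst (pos v) (pos v) <= r.
  by rewrite /dst !subrr normr0 maxxx ltW // (lt_le_trans eps0).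
have [||y [a [s [/andP[Py ya] ps ls aN ss]]]] := last_exit pL (P := P).
- by rewrite /= self.
- by rewrite lL /= -ltNge; lra.
rewrite /close in ya.
(* The boxes are too far apart for a to lie in the one of the target. *)
have aQ : ~~ Q a.
  rewrite /= -ltNge; move: Py => /= Py.
  have := dst_triangle (pos (src e)) y (pos (tgt e)); have := dst_triangle y a (pos (tgt e)).
  by rewrite [dst a _]dstC; lra.
have [|l [b [pl lb Qb lN sl]]] := first_entry ps aQ; first by rewrite ls lL /= self.
exists a, l; split=> //.
- by move=> p /sl /ss pL'; apply: sL; rewrite inE pL' orbT.
- move=> p v pl'; rewrite endsE !inE => /orP[]/eqP->.
    by have /allP/(_ _ (sl _ pl')) := aN; rewrite /= -ltNge.
  by have /allP/(_ _ pl') := lN; rewrite /= -ltNge.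
- by move: Py ya => /=; have := dst_triangle (pos (src e)) y a; lra.
move: Qb lb; rewrite /close /=; have := dst_triangle (pos (tgt e)) b (last a l).
by rewrite [dst b _]dstC; lra.
Qed.

(** Inner segments have length less than eps and stay close to their arc, so they
    avoid all other arcs, which are at distance at least eta >= 3 eps. A first
    segment is straight inside the box of its vertex and leaves that box by less
    than eps: it can only be met by another first segment at the same vertex, and
    if the two had a common point besides the vertex, they would have the same
    direction and their ends, of nearly equal distance from the vertex, would be
    too close. *)
Lemma rotation_system : exists (c : V -> E -> bool) (ang : V -> E -> R),
  (forall v e f, v \in ends e -> v \in ends f -> ang v e = ang v f -> e = f) /\
  (forall e u v (z : {set E}), u \in ends e -> v \in ends e ->
    even_set ends z -> e \notin z -> parity z (before ends c ang u e) = parity z (before ends c ang v e)).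
Proof.
have [r r0 [gapV gapE]] := vertex_gap; have [eta eta0 gapA] := arc_gap r0.
pose eps := Num.min r (eta / 3).
have eps0 : 0 < eps by rewrite lt_min r0 divr_gt0.
have eps_r : eps <= r by rewrite ge_min lexx.
have eps_eta : 3 * eps <= eta.
  have : eps <= eta / 3 by rewrite ge_min lexx orbT.
  by lra.
have /boolp.choice[a /boolp.choice[l polyP]] e := trimmed_polygon eps0 eps_r (gapV _ _ (src_tgt e)).
have inarc e p : p \in a e :: l e -> exists2 t, 0 <= t <= 1 & p = arc e t by have [_ H _ _ _] := polyP e; apply: H.
have outbox e p v : p \in a e :: l e -> v \in ends e -> r < dst (pos v) p by have [_ _ H _ _] := polyP e; apply: H.
have dirin v e : dir src a l v e \in a e :: l e.
  by rewrite /dir; case: ifP => _; rewrite ?mem_head ?mem_last.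
have dir_near v e : v \in ends e -> dst (pos v) (dir src a l v e) < r + eps.
  have [_ _ _ H1 H2] := polyP e; rewrite /dir endsE !inE => /orP[]/eqP->; first by rewrite eqxx.
  by rewrite eq_sym (negPf (src_tgt e)).
have far e f p q : e != f -> p \in a e :: l e -> q \in a f :: l f -> eta <= dst p q.
  move=> ef pe; have [t t01 pt_] := inarc e p pe; move=> /inarc[s s01 ->]; rewrite pt_.
  by apply: (gapA e f) => // v; rewrite inE -pt_ => /andP[ve _]; apply: (outbox e).
have midP e s : s \in mids a l e -> [/\ s.1 \in a e :: l e, s.2 \in a e :: l e & dst s.1 s.2 < eps].
  by have [H _ _ _ _] := polyP e; apply: (mem_pairmap H).
have on_mid e s t : s \in mids a l e -> 0 <= t <= 1 -> dst s.1 (point_at s.1 s.2 t) < eps.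
  move=> /midP[_ _ lt] /andP[t0 t1]; rewrite dst_point_at //; apply: le_lt_trans lt.
  by rewrite ler_piMl ?dst_ge0.
have on_dir e v t : v \in ends e -> 0 <= t <= 1 -> dst (pos v) (point_at (pos v) (dir src a l v e) t) < r + eps.
  move=> /dir_near lt /andP[t0 t1]; rewrite dst_point_at //; apply: le_lt_trans lt.
  by rewrite ler_piMl ?dst_ge0.
have mid_mid e f s t : e != f -> s \in mids a l e -> t \in mids a l f -> disjoint_segs s.1 s.2 t.1 t.2.
  move=> ef se tf x y x01 y01 xy; have [s1 _ _] := midP e s se; have [t1 _ _] := midP f t tf.
  have := far e f _ _ ef s1 t1; have := on_mid e s x se x01; have := on_mid f t y tf y01.
  by have := dst_triangle s.1 (point_at s.1 s.2 x) t.1; rewrite xy [dst (point_at _ _ _) t.1]dstC; lra.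
have dir_mid e f v t : e != f -> v \in ends e -> t \in mids a l f ->
    disjoint_segs (pos v) (dir src a l v e) t.1 t.2.
  move=> ef ve tf x y x01 y01 xy; have [t1 _ _] := midP f t tf.
  have h1 := on_mid f t y tf y01; have h2 := on_dir e v x ve x01.
  have h3 := dst_triangle (pos v) (point_at t.1 t.2 y) t.1; rewrite [dst (point_at _ _ _) t.1]dstC in h3.
  case: (boolP (v \in ends f)) => [vf|vN]; last first.
    have [s s01 t1E] := inarc f _ t1.
    by have := gapE f v s vN s01; rewrite -t1E; move: h2; rewrite xy; lra.
  have h4 := outbox f _ v t1 vf; have h5 := far e f _ _ ef (dirin v e) t1.
  have h6 := dst_triangle (dir src a l v e) (point_at t.1 t.2 y) t.1; rewrite [dst (point_at _ _ _) t.1]dstC in h6.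
  have /andP[x0 x1] := x01.
  have h7 := dst_point_at_end (pos v) (dir src a l v e) x1; rewrite dstC xy in h7.
  have h8 := dst_point_at (pos v) (dir src a l v e) x0; rewrite xy in h8.
  have := dir_near v e ve; lra.
have dir_dir e f v w : e != f -> v \in ends e -> w \in ends f -> v != w ->
    disjoint_segs (pos v) (dir src a l v e) (pos w) (dir src a l w f).
  move=> ef ve wf vw x y x01 y01 xy; have := on_dir e v x ve x01; have := on_dir f w y wf y01.
  have := dst_triangle (pos v) (point_at (pos v) (dir src a l v e) x) (pos w).
  by have := gapV v w vw; rewrite xy [dst (point_at _ _ _) (pos w)]dstC; lra.
have dir_star e f v s t : e != f -> v \in ends e -> v \in ends f ->
    0 < s <= 1 -> 0 < t <= 1 -> point_at (pos v) (dir src a l v e) s <> point_at (pos v) (dir src a l v f) t.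
  wlog st : e f s t / s <= t.
    move=> W ef ve vf s1 t1; case: (leP s t) => [st|/ltW ts]; first exact: W.
    by move=> /esym; apply: W; rewrite // eq_sym.
  move=> ef ve vf /andP[s0 s1] /andP[t0 t1] st_eq.
  have fe : f != e by rewrite eq_sym.
  (* the nearer point dir v f lies on the segment to dir v e, at parameter s / t *)
  have x0 : 0 <= s / t by rewrite divr_ge0 // ltW.
  have x1 : s / t <= 1 by rewrite ler_pdivrMr // mul1r.
  have dirE : dir src a l v f = point_at (pos v) (dir src a l v e) (s / t).
    case: st_eq => H1 H2; rewrite [LHS]surjective_pairing /point_at; congr (_, _).
      by move/addrI: H1 => H1; rewrite mulrAC H1 [t * _]mulrC mulfK ?gt_eqF // subrKC.
    by move/addrI: H2 => H2; rewrite mulrAC H2 [t * _]mulrC mulfK ?gt_eqF // subrKC.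
  have := far f e _ _ fe (dirin v f) (dirin v e).
  have := dst_point_at_end (pos v) (dir src a l v e) x1; have := dst_point_at (pos v) (dir src a l v e) x0.
  rewrite -dirE; have := outbox f _ v (dirin v f) vf; have := dir_near v e ve; lra.
have dir_neq e v : v \in ends e -> dir src a l v e != pos v.
  move=> ve; apply: contraTneq (outbox e _ v (dirin v e) ve) => ->.
  by rewrite /dst !subrr normr0 maxxx -leNgt ltW.
exists (crossings pos src tgt a l), (angle pos src a l); split.
  by apply: (angle_inj dir_star dir_neq).
apply: (polygon_certificate endsE src_tgt mid_mid dir_mid dir_dir dir_star dir_neq).
Qed.
End Drawing.

(** * The theorem *)

Section Graphs.
Variable G : sgraph.
Implicit Types (e : edge G) (x y v : G).

Lemma edgeP e : exists x y, [/\ adj x y, x != y & val e = [set x; y]].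
Proof.
case: e => s /= /imsetP[[x y]]; rewrite inE /= => xy ->; exists x, y; split=> //.
by apply: contraTneq xy => ->; rewrite adj_irr.
Qed.

Lemma edge_card2 e : #|val e| = 2.
Proof. by have [x [y [_ xy ->]]] := edgeP e; rewrite cards2 xy. Qed.

Lemma edge_adj e x y : x != y -> val e = [set x; y] -> adj x y.
Proof.
move=> xy Ee; have [u [w [uw _ Ee']]] := edgeP e.
have : x \in [set u; w] /\ y \in [set u; w] by rewrite -Ee' Ee !inE !eqxx orbT.
rewrite !inE => -[/orP[]/eqP Ex /orP[]/eqP Ey]; rewrite Ex Ey ?eqxx // in xy *.
by rewrite adj_sym.
Qed.

Lemma no_four_cycle : ~ has_cycle_of_length G 4 -> forall x y u w (e1 e2 e3 e4 : edge G),
  uniq [:: x; y; u; w] -> val e1 = [set x; y] -> val e2 = [set y; u] ->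
  val e3 = [set u; w] -> val e4 = [set w; x] -> False.
Proof.
move=> noC x y u w e1 e2 e3 e4 un E1 E2 E3 E4; apply: noC; exists [:: x; y; u; w]; split=> //.
rewrite /ucycle un andbT /=.
move: un; rewrite /= !inE !negb_or => /and4P[/and3P[xy xu xw] /andP[yu yw] uw _].
by rewrite (edge_adj xy E1) (edge_adj yu E2) (edge_adj uw E3) (edge_adj _ E4) // eq_sym.
Qed.

Lemma deg_max v : (deg (val : edge G -> {set G}) [set: edge G] v <= max_degree G)%N.
Proof.
apply: leq_trans (leq_bigmax v); rewrite /deg /degree -(card_imset _ val_inj).
apply: leq_trans (leq_imset_card (fun w => [set v; w]) [set w | adj v w]).
apply: subset_leq_card; apply/fintype.subsetP => s /imsetP[e]; rewrite !inE /= => ve ->.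
have [w wv Ee] := other_end edge_card2 ve.
by apply/imsetP; exists w; rewrite // inE; apply: (edge_adj _ Ee); rewrite eq_sym.
Qed.
End Graphs.

Lemma list_of_set (A : choiceType) (S : set A) k : (S #= `I_k)%card ->
  exists s : seq A, [/\ uniq s, size s = k & forall x, x \in s -> S x].
Proof.
move=> Sk; have fS : finite_set S by apply/finite_setP; exists k.
exists (enum_fset (fset_set S)); split; [exact: fset_uniq|exact: card_fset_set|].
by move=> x; rewrite (in_fset_set fS) => /set_mem.
Qed.

Section Shifts.
Variables (H : sgraph) (D : rel H) (A : zmodType) (f : edge H -> A).
Hypothesis D_or : orientation D.

(** The forbidden difference c x - c y; the sign compensates for an edge that is
    directed from y to x. *)
Definition shift (x y : H) : A :=
  if [pick e : edge H | val e == [set x; y]] is Some e then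
    if D x y then f e else - f e
  else 0.

Lemma shiftN x y : shift y x = - shift x y.
Proof.
rewrite /shift setUC; case: pickP => [e /eqP Ee|_]; last by rewrite oppr0.
case: (eqVneq x y) Ee => [->|xy Ee]; last first.
  by have := D_or.2 _ _ (edge_adj xy Ee); case: (D x y); case: (D y x); rewrite //= opprK.
by have := edge_card2 e => + Ee; rewrite Ee setUid cards1.
Qed.

Lemma coloring_of_shift (c : H -> A) (L : H -> set A) :
  (forall x, L x (c x)) -> (forall x y, adj x y -> c x != c y + shift x y) ->
  coloring D L f c.
Proof.
move=> cL cs; split=> // e x y Ee Dxy.
have := cs x y (D_or.1 _ _ Dxy); rewrite /shift Dxy; case: pickP => [e' /eqP Ee'|/(_ e)]; last first.
  by rewrite Ee eqxx.
have -> : e' = e by apply: val_inj; rewrite Ee.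
by move=> /eqP ne cE; apply: ne; rewrite -cE subrKC.
Qed.
End Shifts.

Theorem theorem3p3 (R : realType) (G : sgraph) :
  planar R G ->
  ~ has_cycle_of_length G 4 ->
  (5 <= max_degree G)%N ->
  edge_group_choosable G (max_degree G).+1.
Proof.
move=> [pos [arc [pos_inj arcP arc_ends arc_pos arc_arc]]] noC D5 A _ L L_k D D_or f.
have noC4 := no_four_cycle noC.
have /boolp.choice[src /boolp.choice[tgt endP]] := arc_ends.
have arc_in e t v : 0 < t < 1 -> arc e t <> pos v.
  by move=> t01; apply: arc_pos; rewrite in_itv.
have arc_in2 e1 e2 t1 t2 : 0 < t1 < 1 -> 0 < t2 < 1 -> arc e1 t1 = arc e2 t2 -> e1 = e2.
  by move=> t01 t02; apply: arc_arc; rewrite in_itv.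
have [c [ang [ang_inj cert]]] := @rotation_system R G (edge G) val val_inj (@edge_card2 G)
  pos arc src tgt (fun e => let: And3 H _ _ := endP e in H) pos_inj
  (fun e => within_cont01 (arcP e).1) (fun e => let: And3 _ H _ := endP e in H)
  (fun e => let: And3 _ _ H := endP e in H) arc_in arc_in2.
have /boolp.choice[s sP] e := list_of_set (L_k e).
have [col [colL colP]] := line_colorable val_inj (@edge_card2 G) noC4 ang_inj cert D5
  (@deg_max G) (shiftN f D_or) (fun e => let: And3 H _ _ := sP e in H)
  (fun e => let: And3 _ H _ := sP e in H) (finset.setTfor (edge G)).
exists col; apply: coloring_of_shift => // [e|e e' adj_ee'].
  by have [_ _] := sP e; apply; apply: colL; rewrite inE.
by apply: colP; rewrite ?inE.
Qed.
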